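(* For $w\in A_1$ and $f\in \mathrm{BMO}_{\mathcal{A}}(X,w)$, there exist positive constants $c_1$ and $c_2$ such that for any ball $B$ and any $\lambda>0$, $$w\big(\{x\in B:|(f(x)-\mathcal{A}_{t_B}f(x))\,w^{-1}(x)|>\lambda\}\big)\le c_1\, w(B)\exp\Big(-\frac{c_2\lambda}{\|f\|_{\mathrm{BMO}_{\mathcal{A}}(X,w)}}\Big),$$ where $t_B=r_B^m$ and $r_B$ is the radius of $B$.
   Context: Setting. $(X,d)$ is a metric space with a nonnegative Borel measure $\mu$ that is doubling: there is $C\ge 1$ with $\mu(B(x,2r))\le C\mu(B(x,r))<\infty$ for all $x\in X$, $r>0$, where $B(x,r)=\{y:d(x,y)<r\}$; balls have positive measure. Write $V(E)=\mu(E)$, $V(x,r)=\mu(B(x,r))$; for a ball $B$, $r_B$ is its radius. Weights. A weight $w$ is a nonnegative locally integrable function on $X$ (not a.e. zero); $w(E)=\int_E w\,d\mu$. $w\in A_1$ means there is $C$ such that for every ball $B$, $\frac1{V(B)}\int_B w\,d\mu\le C\,w(x)$ for a.e. $x\in B$. The family $\{\mathcal{A}_t\}_{t>0}$. Each $\mathcal{A}_t$ is an integral operator $\mathcal{A}_tf(x)=\int_X a_t(x,y)f(y)\,d\mu(y)$, with kernel satisfying, for fixed constants $m\ge 2$, $C,c>0$, $$|a_t(x,y)|\le \frac{C}{V(x,t^{1/m})}\exp\Big(-c\,\frac{d(x,y)^{m/(m-1)}}{t^{1/(m-1)}}\Big)\quad\text{for all } t>0,\ x,y\in X,$$ and the operators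 commute: $\mathcal{A}_s\mathcal{A}_t=\mathcal{A}_t\mathcal{A}_s$ for all $s,t>0$ (no semigroup property is assumed). The class $\mathcal{M}$. For $x_0\in X$, $\beta>0$, $f\in L^1_{loc}(X)$ is of type $(x_0,\beta)$ if $\int_X \frac{|f(x)|^2}{(1+d(x_0,x))^{\beta}V(x_0,1+d(x_0,x))}\,d\mu(x)<\infty$. $\mathcal{M}$ is the set of all functions of type $(x_0,\beta)$ for some $x_0\in X$, $0<\beta<\infty$. The operators $\mathcal{A}_t$ act on $\mathcal{M}$ by the integral $\mathcal{A}_tf(x)=\int_X a_t(x,y)f(y)\,d\mu(y)$. $\mathrm{BMO}_{\mathcal{A}}(X,w)$ is the set of $f\in\mathcal{M}$ with $$\|f\|_{\mathrm{BMO}_{\mathcal{A}}(X,w)}=\sup_B\frac1{w(B)}\int_B|(I-\mathcal{A}_{t_B})f|\,d\mu<\infty,\qquad t_B=r_B^m,$$ the supremum being over all balls $B$. When $\|f\|_{\mathrm{BMO}_{\mathcal{A}}(X,w)}=0$, the right-hand side of the estimate is read as $0$. *)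

(* Defs.v *)
From HB Require Import structures.
From mathcomp Require Import all_boot all_order all_algebra.
From mathcomp Require Import all_classical all_reals all_analysis.
From mathcomp.real_closed Require Export complex.

Set Implicit Arguments.
Unset Strict Implicit.
Unset Printing Implicit Defensive.

Import Order.TTheory GRing.Theory Num.Theory.
Import numFieldNormedType.Exports.

Local Open Scope classical_set_scope.
Local Open Scope ring_scope.
Local Open Scope complex_scope.

(* Metric spaces with a distinguished point: every measurableType is pointed,
   so the Borel sigma-algebra of a metricType needs one. *)
#[short(type="pmetricType")]
HB.structure Definition PointedMetric (R : numDomainType) :=
  { X of Pointed X & Metric R X }.

Notation borel X := (g_sigma_algebraType (@open X)).

Section homogeneous_space.
Context {R : realType} {X : pmetricType R}.
Implicit Types (mu : {measure set (borel X) -> \bar R}) (w g : X -> R)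
  (x y : X) (r t m beta : R).

Definition vol mu x r : R := fine (mu (ball x r)).

Definition doubling mu : Prop :=
  exists2 C : R, 1 <= C & forall x r, 0 < r ->
    (mu (ball x (2 * r)) <= C%:E * mu (ball x r) < +oo)%E.

Definition balls_positive mu : Prop :=
  forall x r, 0 < r -> (0 < mu (ball x r))%E.

(* In a doubling space "locally" means "on every ball". *)
Definition loc_integrable mu g : Prop :=
  forall x r, 0 < r -> mu.-integrable (ball x r) (EFin \o g).

Definition cloc_integrable mu (f : X -> R[i]) : Prop :=
  loc_integrable mu (fun x => complex.Re (f x)) /\ loc_integrable mu (fun x => complex.Im (f x)).

Definition cintegral mu (h : X -> R[i]) : R[i] :=
  (\int[mu]_x complex.Re (h x)) +i* (\int[mu]_x complex.Im (h x)).

(* The modulus as an element of R; `|z| would be an element of R[i]. *)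
Definition cabs (z : R[i]) : R := complex.Re `|z|.

Definition wmeas mu w (E : set X) : \bar R := (\int[mu]_(x in E) (w x)%:E)%E.

Definition is_weight mu w : Prop :=
  [/\ forall x, 0 <= w x, loc_integrable mu w
    & ~ {ae mu, forall x, w x = 0}].

Definition is_A1 mu w : Prop :=
  is_weight mu w /\
  exists C : R, forall x r, 0 < r ->
    {ae mu, forall y, ball x r y ->
      (wmeas mu w (ball x r) / mu (ball x r) <= (C * w y)%:E)%E}.

Section operators.
Context (mu : {measure set (borel X) -> \bar R}) (a : R -> X -> X -> R[i]).

Definition kernel_measurable : Prop :=
  forall t, 0 < t ->
    measurable_fun setT (fun p : borel X * borel X => complex.Re (a t p.1 p.2)) /\
    measurable_fun setT (fun p : borel X * borel X => complex.Im (a t p.1 p.2)).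

Definition kernel_bound (m C c : R) : Prop :=
  forall t x y, 0 < t ->
    cabs (a t x y) <= C / vol mu x (t `^ m^-1) *
      expR (- (c * (mdist x y `^ (m / (m - 1)) / t `^ (m - 1)^-1))).

Definition opA t (f : X -> R[i]) : X -> R[i] :=
  fun x => cintegral mu (fun y => a t x y * f y).

Definition of_type x0 beta (f : X -> R[i]) : Prop :=
  cloc_integrable mu f /\
  (\int[mu]_x (cabs (f x) ^+ 2 /
     ((1 + mdist x0 x) `^ beta * vol mu x0 (1 + mdist x0 x)))%:E < +oo)%E.

Definition classM (f : X -> R[i]) : Prop :=
  exists x0 beta, 0 < beta /\ of_type x0 beta f.

Definition operators_commute : Prop :=
  forall s t f, 0 < s -> 0 < t -> classM f ->
    {ae mu, forall x, opA s (opA t f) x = opA t (opA s f) x}.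

(* A ball is represented by its center and radius, since the radius enters
   t_B = r_B ^ m and need not be determined by the underlying set. *)
Definition bmo_norm m w (f : X -> R[i]) : \bar R :=
  ereal_sup [set ((\int[mu]_(x in ball B.1 B.2)
                     (cabs (f x - opA (B.2 `^ m) f x))%:E)
                  / wmeas mu w (ball B.1 B.2))%E
            | B in [set B : X * R | 0 < B.2]].

Definition in_BMO m w (f : X -> R[i]) : Prop :=
  classM f /\ (bmo_norm m w f < +oo)%E.

End operators.

End homogeneous_space.

(* Main.v *)
Require Import Defs.
From HB Require Import structures.
From mathcomp Require Import all_boot all_order all_algebra.
From mathcomp Require Import all_classical all_reals all_analysis.
From mathcomp Require Import measurable_realfun ring lra.

Set Implicit Arguments.
Unset Strict Implicit.
Unset Printing Implicit Defensive.

Import Order.TTheory GRing.Theory Num.Theory.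
Import numFieldNormedType.Exports.

Local Open Scope classical_set_scope.
Local Open Scope ring_scope.
Local Open Scope complex_scope.

(** The proof is a good-lambda induction in the style of John and Nirenberg,
    run on the oscillations h_s = |f - A_(s^m) f|, one function for each scale
    s, instead of on the differences between f and its averages.

    Let N be the BMO norm and B a ball of radius r.  Replacing the measure by
    w dmu, which the A1 condition makes doubling ([wmeas_doubling]), a
    Calderon-Zygmund argument ([stopping_balls]) selects balls B_i of radii
    s_i <= r whose total w-measure is at most half that of B, such that the
    averages of h_r with respect to w are at most a multiple of N on each B_i
    and on the larger dyadic balls around its centre up to radius r, while off the B_i the
    function h_r itself is almost everywhere at most a multiple of N w.
    On B_i the scale is changed from r to s_i at the cost of a multiple
    of N w ([osc_comparison]):
      h_r <= h_(s_i) + L N w   almost everywhere on B_i.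
    Thus the part of B where h_r > (n + 1) L N w lies, up to a null set, in the
    union of the parts of the B_i where h_(s_i) > n L N w, and by induction
    on n its w-measure is at most 2^-(n+1) w(B) ([exceedance_decay]).  This is
    the exponential decay of the theorem.

    The change of scale is where the operators enter.  Since A_(s^m) and
    A_(r^m) commute,
      A_(s^m) f - A_(r^m) f
        = A_(s^m) (f - A_(r^m) f) - A_(r^m) (f - A_(s^m) f),
    so that the difference is controlled by averages of h_r against the kernel
    at scale s and of h_s against the kernel at scale r ([opA_difference]).
    The kernel decays faster than any geometric sequence along dyadic balls
    ([kernel_decay]), so polynomial growth of the integrals over these balls
    is enough to bound such an average ([kernel_average]).  For h_r at scale
    s the growth comes from the stopping condition.  For balls larger than the
    scale of the oscillation it comes from packing a ball with balls of that
    scale, on each of which the BMO norm applies ([osc_large_ball]).  The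
    bounds obtained are w-measures of balls divided by their mu-measures, and
    the A1 condition turns these into pointwise multiples of w
    ([kernel_int_le_weight]).

    Two tools of analysis on doubling metric spaces are established on the way:
    a Vitali covering lemma for dyadic radii ([metric_vitali]) and, as a
    replacement of the Lebesgue differentiation theorem, a comparison of two
    measures from their values on small balls ([le_measure_of_small_balls]),
    which rests on the outer regularity of finite Borel measures
    ([metric_outer_regular]). *)


(** * The modulus of complex numbers, metric balls, and a Vitali covering lemma *)

Section modulus.
Context {R : realType}.
Implicit Types z : R[i].

Lemma cabsE z : cabs z = Num.sqrt (complex.Re z ^+ 2 + complex.Im z ^+ 2).
Proof. by case: z. Qed.

Lemma cabs_ge0 z : 0 <= cabs z.
Proof. by rewrite cabsE sqrtr_ge0. Qed.

Lemma cabsM z1 z2 : cabs (z1 * z2) = cabs z1 * cabs z2.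
Proof. by rewrite /cabs normrM; case: z1 z2 => [a b] [c d] /=; rewrite mulr0 subr0. Qed.

Lemma cabsD z1 z2 : cabs (z1 + z2) <= cabs z1 + cabs z2.
Proof.
have := ler_normD z1 z2.
by rewrite lecE => /andP[_]; case: z1 z2 => [a b] [c d].
Qed.

Lemma cabsN z : cabs (- z) = cabs z.
Proof. by rewrite /cabs normrN. Qed.

Lemma cabs_real (r : R) : cabs r%:C%C = `|r|.
Proof. by rewrite cabsE /= expr0n addr0 sqrtr_sqr. Qed.

Lemma Re_le_cabs z : `|complex.Re z| <= cabs z.
Proof. by rewrite cabsE -sqrtr_sqr ler_wsqrtr// lerDl sqr_ge0. Qed.

Lemma Im_le_cabs z : `|complex.Im z| <= cabs z.
Proof. by rewrite cabsE -sqrtr_sqr ler_wsqrtr// lerDr sqr_ge0. Qed.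

Lemma cabs_le_ReIm z : cabs z <= `|complex.Re z| + `|complex.Im z|.
Proof.
case: z => a b; have := cabsD (a%:C%C) ((0 +i* b)%C).
rewrite -[(a%:C + _)%C]/((a + 0) +i* (0 + b))%C addr0 add0r cabs_real /=.
by rewrite (cabsE (0 +i* b)%C) /= expr0n add0r sqrtr_sqr.
Qed.

End modulus.

Section balls.
Context {R : realType} {X : pmetricType R}.
Implicit Types (x y z : X) (r s : R).

Lemma ballP x r y : ball x r y <-> mdist x y < r.
Proof. by rewrite ballEmdist. Qed.

Lemma subset_ball_dist x y r s : mdist x y + r <= s -> ball y r `<=` ball x s.
Proof.
move=> xys z /ballP yz; apply/ballP.
by rewrite (le_lt_trans (metric_triangle x y z))// (lt_le_trans _ xys)// ltrD2l.
Qed.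

Lemma open_metric_ball x r : open (ball x r : set X).
Proof.
rewrite openE => y /ballP xy; rewrite /interior.
apply/nbhs_ballP; exists (r - mdist x y) => /=; first by rewrite subr_gt0.
by apply: subset_ball_dist; rewrite addrCA subrr addr0.
Qed.

Lemma measurable_open (U : set X) : open U -> measurable (U : set (borel X)).
Proof. by move=> oU; apply: sub_sigma_algebra. Qed.

Lemma measurable_metric_ball x r : measurable (ball x r : set (borel X)).
Proof. by apply: measurable_open; exact: open_metric_ball. Qed.

Lemma bigcup_metric_ball x : \bigcup_n ball x n.+1%:R = [set: X].
Proof.
apply/seteqP; split => // y _; exists (Num.truncn (mdist x y)) => //.
apply/ballP; apply: truncnS_gt.
Qed.

End balls.
#[global] Hint Extern 0 (measurable (ball _ _)) =>
  solve [apply: measurable_metric_ball] : core.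

Section disjoint_families.
Context d (T : measurableType d) (R : realType) (mu : {measure set T -> \bar R}).

(** More than mu(Y) / e disjoint sets of measure at least e do not fit into Y. *)
Lemma finite_disjoint_large (I : pointedType) (S : set I) (F : I -> set T) (Y : set T)
    (e : R) : 0 < e -> measurable Y -> (mu Y < +oo)%E ->
  (forall i, S i -> [/\ measurable (F i), F i `<=` Y & (e%:E <= mu (F i))%E]) ->
  trivIset S F -> finite_set S.
Proof.
move=> e0 mY Yoo SF tF; apply: contrapT => /infiniteP /pcard_leP[g].
pose G n := F (g n).
have Sg n : S (g n) by exact: funS.
have tG : trivIset setT G.
  move=> i j _ _ ij; apply: (@inj _ _ setT g); rewrite ?inE//.
  exact: tF ij.
have Yfin : mu Y \is a fin_num by rewrite ge0_fin_numE.
have h n : n%:R * e <= fine (mu Y).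
  rewrite -lee_fin fineK//.
  have mG k : measurable (G k) by have [] := SF _ (Sg k).
  apply: (@le_trans _ _ (mu (\big[setU/set0]_(k < n) G k))); last first.
    apply: le_measure; rewrite ?inE//; first exact: bigsetU_measurable.
    by rewrite -bigcup_mkord; apply: bigcup_sub => k _; have [] := SF _ (Sg k).
  rewrite measure_bigsetU//.
  apply: (@le_trans _ _ (\sum_(k < n) e%:E)%E).
    by rewrite sumEFin lee_fin sumr_const card_ord mulr_natl.
  by apply: lee_sum => k _; have [] := SF _ (Sg k).
have := h (Num.truncn (fine (mu Y) / e)).+1.
by rewrite leNgt -ltr_pdivrMr// truncnS_gt.
Qed.

(** The indices are sorted according to the n with mu(F i) >= 1 / (n + 1);
    each class is finite. *)
Lemma countable_disjoint_pos (I : pointedType) (S : set I) (F : I -> set T) (Y : set T) :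
  measurable Y -> (mu Y < +oo)%E ->
  (forall i, S i -> [/\ measurable (F i), F i `<=` Y & (0 < mu (F i))%E]) ->
  trivIset S F -> countable S.
Proof.
move=> mY Yoo SF tF.
suff -> : S = \bigcup_n [set i | S i /\ ((n.+1%:R^-1)%:E <= mu (F i))%E].
  apply: bigcup_countable => // n _; apply: finite_set_countable.
  apply: (@finite_disjoint_large _ _ F Y n.+1%:R^-1); rewrite ?invr_gt0 ?ltr0n//.
    by move=> i [Si le]; have [] := SF _ Si.
  by apply: sub_trivIset tF => i [].
apply/seteqP; split => [i Si|i [n _ []]//].
have [mF FY F0] := SF _ Si.
have Ffin : mu (F i) \is a fin_num.
  rewrite ge0_fin_numE//; apply: le_lt_trans Yoo.
  by apply: le_measure; rewrite ?inE.
exists (Num.truncn (fine (mu (F i)))^-1) => //=; split => //.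
rewrite -(fineK Ffin) lee_fin -[leRHS]invrK lef_pV2 ?posrE ?invr_gt0 ?ltr0n//.
  exact/ltW/truncnS_gt.
by rewrite -lte_fin fineK.
Qed.

End disjoint_families.

Section vitali.
Context {R : realType} {X : pmetricType R}.
Variable mu : {measure set (borel X) -> \bar R}.
Hypothesis mu_balls : balls_positive mu.

(** Zorn's lemma yields a maximal disjoint family S among those for which a ball
    that meets S meets a member of S of at least its own radius.  If some balls
    missed S, one of largest radius among them could be added to S.  A largest
    one exists because the radii are dyadic.  The centre of a ball that meets a
    ball of at least its own radius lies in the double of the latter. *)
Lemma metric_vitali (E : set X) (x0 : X) (r0 s : R) (j : X -> nat) : 0 < s ->
  (mu (ball x0 r0) < +oo)%E ->
  (forall x, E x -> ball x (s / 2 ^+ j x) `<=` ball x0 r0) ->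
  exists (D : set nat) (z : nat -> X),
    [/\ forall n, D n -> E (z n),
        trivIset D (fun n => ball (z n) (s / 2 ^+ j (z n))) &
        E `<=` \bigcup_(n in D) ball (z n) (2 * (s / 2 ^+ j (z n)))].
Proof.
move=> s0 fin0 EB0.
pose rho x := s / 2 ^+ j x.
have rho0 x : 0 < rho x by rewrite divr_gt0// exprn_gt0.
have rho_le x y : (j x <= j y)%N -> rho y <= rho x.
  move=> jxy; rewrite ler_pM2l// lef_pV2 ?posrE ?exprn_gt0//.
  by rewrite ler_eXn2l// ltr1n.
pose B x := ball x (rho x).
pose meets x y := B x `&` B y !=set0.
pose P (S : set X) := [/\ S `<=` E, trivIset S B &
  forall x y, E x -> S y -> meets x y ->
    exists y', [/\ S y', meets x y' & (j y' <= j x)%N]].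
have [S [[SE tS domS] maxS]] : exists S, P S /\ forall S', S `<` S' -> ~ P S'.
  apply: Zorn_bigcup => F FP totF; split.
  - by move=> x [S FS Sx]; have [+ _ _] := FP _ FS; exact.
  - move=> x y [S FS Sx] [S' FS' S'y] xy.
    have [SS'|S'S] := totF _ _ FS FS'.
      by have [_ t _] := FP _ FS'; apply: t => //; exact: SS'.
    by have [_ t _] := FP _ FS; apply: t => //; exact: S'S.
  - move=> x y Ex [S FS Sy] xy; have [_ _ t] := FP _ FS.
    by have [y' [Sy' ? ?]] := t _ _ Ex Sy xy; exists y'; split=> //; exists S.
(* The largest ball missing S is the one with the least exponent j. *)
have cov x : E x -> exists2 y, S y & meets x y.
  move=> Ex; apply: contrapT => Nx.
  pose free n := `[< exists x, [/\ E x, ~ (exists2 y, S y & meets x y) & j x = n] >].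
  have exf : exists n, free n by exists (j x); apply/asboolP; exists x.
  case: (ex_minnP exf) => n /asboolP[u [Eu Nu ju]] minn.
  have NSu : ~ S u.
    move=> Su; apply: Nu; exists u => //; exists u; split; exact: ballxx.
  have : P (S `|` [set u]).
    split.
    - by move=> v [/SE//|->].
    - move=> v v' [Sv|->] [Sv'|->] //; first exact: tS.
      + by move=> vu; exfalso; apply: Nu; exists v; rewrite // /meets setIC.
      + by move=> vu; exfalso; apply: Nu; exists v'.
    - move=> v y Ev Sy vy.
      have [[y' Sy' vy']|Nv] := pselect (exists2 y, S y & meets v y).
        have [y'' [? ? ?]] := domS _ _ Ev Sy' vy'.
        by exists y''; split=> //; left.
      case: Sy => [Sy|yu]; first by exfalso; apply: Nv; exists y.
      exists u; split; [by right|by rewrite -yu|].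
      by rewrite ju; apply: minn; apply/asboolP; exists v.
  by apply: maxS; split=> [v Sv|/(_ u (or_intror erefl))//]; left.
have /countable_injP[g ginj] : countable S.
  apply: (@countable_disjoint_pos _ (borel X) R mu X S B (ball x0 r0)) => //.
  move=> x Sx; split; [exact: measurable_metric_ball|exact: (EB0 _ (SE _ Sx))|].
  exact: mu_balls.
exists (g @` S), (pinv S g).
have gK x : S x -> pinv S g (g x) = x by move=> Sx; rewrite pinvKV ?inE.
split.
- by move=> _ [x Sx <-]; rewrite gK//; exact: SE.
- by move=> _ _ [x Sx <-] [y Sy <-]; rewrite !gK// => xy; congr g; exact: tS xy.
- move=> x Ex; have [y Sy xy] := cov _ Ex.
  have [y' [Sy' [v [xv yv]] jy]] := domS _ _ Ex Sy xy.
  exists (g y'); first by exists y'.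
  rewrite gK// mulr_natl mulr2n.
  apply: (ball_triangle yv); apply/ball_sym; apply: le_ball xv.
  exact: rho_le.
Qed.

End vitali.

(** * Outer regularity of finite Borel measures *)

Section outer_regularity.
Context {R : realType} {X : pmetricType R}.
Variable mu : {measure set (borel X) -> \bar R}.
Hypothesis mu_fin : (mu setT < +oo)%E.

(** Unlike outer regularity alone, this property is stable under complements, so
    that the sets which have it form a sigma-algebra. *)
Definition sandwiched (A : set (borel X)) := forall e : R, 0 < e ->
  exists U F : set X, [/\ open U, closed F, F `<=` A, A `<=` U &
    (mu (U `\` F) <= e%:E)%E].

Let mO (U : set X) : open U -> measurable (U : set (borel X)).
Proof. exact: measurable_open. Qed.

Let mC (F : set X) : closed F -> measurable (F : set (borel X)).
Proof.
move=> cF; rewrite -(setCK F); apply: measurableC; apply: mO.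
exact: closed_openC.
Qed.

Let le_mu (A B : set (borel X)) : measurable A -> measurable B ->
  A `<=` B -> (mu A <= mu B)%E.
Proof. by move=> mA mB; apply: le_measure; rewrite inE. Qed.

Let muF (A : set (borel X)) : measurable A -> (mu A < +oo)%E.
Proof. by move=> mA; apply: le_lt_trans mu_fin; apply: le_mu. Qed.

Lemma vanishing_tail (F : nat -> set (borel X)) (e : R) : 0 < e ->
  (forall i, measurable (F i)) -> nonincreasing_seq F -> \bigcap_n F n = set0 ->
  exists n, (mu (F n) <= e%:E)%E.
Proof.
move=> e0 mF niF F0.
have := @nonincreasing_cvg_mu _ (borel X) R mu F (muF (mF 0%N)) mF.
rewrite F0 measure0 => /(_ measurable0 niF) cF.
have [|N _ /(_ N (leqnn N))/ltW le] := cF [set x | (x < e%:E)%E].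
  apply: open_nbhs_nbhs; split; first exact: open_ereal_lt_ereal.
  by rewrite /= lte_fin.
by exists N.
Qed.

(** The points of U whose distance to the complement of U is at least 1 / (n + 1)
    form closed sets which increase to U. *)
Lemma sandwiched_open (U : set X) : open U -> sandwiched U.
Proof.
move=> oU e e0.
pose W n := \bigcup_(y in ~` U) ball y n.+1%:R^-1.
have oW n : open (W n) by apply: bigcup_open => y _; exact: open_metric_ball.
have mUW n : measurable (U `&` W n : set (borel X)).
  by apply: measurableI; apply: mO.
have [||n le] := @vanishing_tail (fun n => U `&` W n) e e0 mUW.
- move=> n m nm; apply/subsetPset; apply: setIS => x [y Uy yx].
  exists y => //; apply: le_ball yx.
  by rewrite lef_pV2 ?posrE ?ltr0n// ler_nat.
- rewrite -subset0 => x UWx; have [Ux _] := UWx 0%N I.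
  have /nbhs_ballP[r /= r0 rU] : nbhs x U by move: oU; rewrite openE; exact.
  have [_ [y Uy yx]] := UWx (Num.truncn r^-1) I.
  apply: Uy; apply: rU; apply/ball_sym; apply: le_ball yx.
  rewrite -[leRHS]invrK lef_pV2 ?posrE ?invr_gt0 ?ltr0n//.
  exact/ltW/truncnS_gt.
exists U, (~` W n); split => //.
- exact: open_closedC.
- by move=> x Wx; apply: contrapT => Ux; apply: Wx; exists x => //; apply: ballxx.
- by rewrite setDE setCK.
Qed.

Lemma sandwichedC (A : set (borel X)) : sandwiched A -> sandwiched (setT `\` A).
Proof.
move=> sA e e0; have [U [F [oU cF FA AU le]]] := sA e e0.
exists (~` F), (~` U); split.
- exact: closed_openC.
- exact: open_closedC.
- by move=> x Ux; split=> // /AU.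
- by move=> x [_ Ax] /FA.
- by rewrite setDE setCK setIC -setDE.
Qed.

(** Only finitely many of the closed sets are united, since a countable union of
    closed sets may fail to be closed; the part which is lost is small by
    continuity of the measure from above.  Half of e is spent on this part and
    the other half on the differences of the given open and closed sets. *)
Lemma sandwiched_bigcup (A : nat -> set (borel X)) :
  (forall n, sandwiched (A n)) -> sandwiched (\bigcup_n A n).
Proof.
move=> sA e e0.
have /choice[UF hUF] : forall n, exists UF : set X * set X,
    [/\ open UF.1, closed UF.2, UF.2 `<=` A n, A n `<=` UF.1 &
    (mu (UF.1 `\` UF.2) <= (e / 2 / (2 ^ n.+1)%:R)%:E)%E].
  move=> n; have [|U [F ?]] := sA n (e / 2 / (2 ^ n.+1)%:R).
    by rewrite !divr_gt0// ltr0n expn_gt0.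
  by exists (U, F).
pose U := \bigcup_n (UF n).1.
pose K n := \bigcup_(i < n) (UF i).2.
have cK n : closed (K n).
  rewrite /K bigcup_mkord.
  by apply: closed_bigsetU => i _; have [_ + _ _ _] := hUF i.
have oU : open U by apply: bigcup_open => n _; have [+ _ _ _ _] := hUF n.
pose Z := \bigcup_n ((UF n).1 `\` (UF n).2).
have mUF n : measurable ((UF n).1 `\` (UF n).2 : set (borel X)).
  by have [? ? _ _ _] := hUF n; apply: measurableD; [exact: mO|exact: mC].
have mZ : measurable (Z : set (borel X)) by apply: bigcup_measurable.
have leZ : (mu Z <= (e / 2)%:E)%E.
  apply: (@le_trans _ _ (\sum_(n <oo) mu ((UF n).1 `\` (UF n).2))%E).
    by apply: measure_sigma_subadditive.
  apply: le_trans (epsilon_trick0 xpredT _); last by rewrite ltW// divr_gt0.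
  by apply: lee_nneseries => // n _; have [_ _ _ _] := hUF n.
have [||||n le] := @vanishing_tail (fun n => U `\` K n `\` Z) (e / 2).
- by rewrite divr_gt0.
- by move=> n; do 2 apply: measurableD => //; [exact: mO|exact: mC].
- move=> n m nm; apply/subsetPset; apply: setSD; apply: setDS => x [i /= ik Fx].
  by exists i => //=; exact: leq_trans nm.
- rewrite -subset0 => x h; have [[[i _ Ux] _] Zx] := h 0%N I.
  have Fx : (UF i).2 x by apply: contrapT => Fx; apply: Zx; exists i.
  by have [[_ +] _] := h i.+1 I; apply; exists i => /=.
exists U, (K n); split => //.
- by move=> x [i _ Fx]; exists i => //; have [_ _ + _ _] := hUF i; apply.
- by move=> x [i _ Ax]; exists i => //; have [_ _ _ + _] := hUF i; apply.
have mUK : measurable (U `\` K n : set (borel X)).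
  by apply: measurableD; [exact: mO|exact: mC].
rewrite [e]splitr EFinD.
apply: (@le_trans _ _ (mu (U `\` K n `\` Z) + mu Z)%E); last exact: leeD.
apply: le_trans (measureU2 _ _ _) => //; last exact: measurableD.
apply: le_mu => //; first by apply: measurableU => //; exact: measurableD.
by move=> x UK; have [Zx|Zx] := pselect (Z x); [right|left].
Qed.

Lemma sandwiched_measurable (A : set (borel X)) : measurable A -> sandwiched A.
Proof.
suff h : <<s @open X >> `<=` sandwiched by move=> mA; exact: h.
apply: smallest_sub => [|U]; last exact: sandwiched_open.
split.
- exact: sandwiched_open open0.
- exact: sandwichedC.
- exact: sandwiched_bigcup.
Qed.

Lemma metric_outer_regular (A : set (borel X)) (e : R) : measurable A -> 0 < e ->
  exists U : set X, [/\ open U, A `<=` U & (mu U <= mu A + e%:E)%E].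
Proof.
move=> mA /(sandwiched_measurable mA)[U [F [oU cF FA AU le]]].
exists U; split => //.
apply: (@le_trans _ _ (mu A + mu (U `\` F))%E); last exact: leeD.
have mUF : measurable (U `\` F : set (borel X)).
  by apply: measurableD; [exact: mO|exact: mC].
apply: le_trans (measureU2 _ _ _) => //; apply: le_mu.
- exact: mO.
- exact: measurableU.
- by move=> x Ux; have [Fx|Fx] := pselect (F x); [left; exact: FA|right].
Qed.

End outer_regularity.

(** * Packings, differentiation and stopping balls for doubling measures *)

Section density.
Context {R : realType} {X : pmetricType R}.
Variables (mu : {measure set (borel X) -> \bar R}) (h : X -> R).
Hypotheses (mh : measurable_fun setT (h : borel X -> R)) (h0 : forall x, 0 <= h x).

(** The set function wmeas mu h as an object to which a measure structure can be
    attached; the two arguments carry the facts that make it a measure. *)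
Definition dens of measurable_fun setT (h : borel X -> R) & (forall x, 0 <= h x) :
  set (borel X) -> \bar R := wmeas mu h.

Local Notation nu := (dens mh h0).

Let nu0 : nu set0 = 0%E. Proof. exact: integral_set0. Qed.

Let nu_ge0 A : (0 <= nu A)%E.
Proof. by apply: integral_ge0 => x _; rewrite lee_fin. Qed.

Let nu_sigma_additive : semi_sigma_additive nu.
Proof.
move=> F mF tF mUF; rewrite /dens /wmeas ge0_integral_bigcup//.
- apply: is_cvg_ereal_nneg_natsum => n _; apply: integral_ge0 => x _.
  by rewrite lee_fin.
- by apply/measurable_EFinP; apply: measurable_funTS.
- by move=> x _; rewrite lee_fin.
Qed.

HB.instance Definition _ := isMeasure.Build _ _ _ nu nu0 nu_ge0 nu_sigma_additive.

End density.

Section doubling_measures.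
Context {R : realType} {X : pmetricType R}.
Variables (om : {measure set (borel X) -> \bar R}) (K : R).
Hypothesis K1 : 1 <= K.
Hypothesis om_dbl : forall x r, 0 < r ->
  (om (ball x (2 * r)) <= K%:E * om (ball x r) < +oo)%E.
Hypothesis om_pos : balls_positive om.

Lemma le_meas (nu : {measure set (borel X) -> \bar R}) (A B : set (borel X)) :
  measurable A -> measurable B -> A `<=` B -> (nu A <= nu B)%E.
Proof. by move=> mA mB; apply: le_measure; rewrite inE. Qed.

Let K0 : 0 <= K. Proof. exact: le_trans K1. Qed.

Lemma doubling_fin x r : (om (ball x r) < +oo)%E.
Proof.
pose s := Num.max r 1; have s0 : 0 < s by rewrite lt_max ltr01 orbT.
apply: (@le_lt_trans _ _ (om (ball x (2 * s)))).
  apply: le_meas => //; apply: le_ball.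
  by apply: (@le_trans _ _ s); [rewrite le_max lexx|lra].
by have /andP[] := om_dbl x s0; exact: le_lt_trans.
Qed.

Lemma doubling_sum (D : set nat) (z : nat -> X) (rho : nat -> R) (Y : set (borel X)) :
  measurable Y -> (forall n, D n -> 0 < rho n) ->
  (forall n, D n -> ball (z n) (rho n) `<=` Y) ->
  trivIset D (fun n => ball (z n) (rho n)) ->
  (\sum_(n <oo | n \in D) om (ball (z n) (2 * rho n)) <= K%:E * om Y)%E.
Proof.
move=> mY rho0 rhoY tD.
apply: (@le_trans _ _ (\sum_(n <oo | n \in D) K%:E * om (ball (z n) (rho n)))%E).
  apply: lee_nneseries => // n; rewrite inE => Dn.
  by have /andP[] := om_dbl (z n) (rho0 _ Dn).
rewrite nneseriesZl//; apply: lee_wpmul2l; first by rewrite lee_fin.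
rewrite -(measure_bigcup om D (fun n => ball (z n) (rho n)))//.
apply: le_meas => //; last by apply: bigcup_sub.
by apply: bigcup_measurable => n _.
Qed.

(** The balls of radius s / 2 of a Vitali family are disjoint and contained in
    the ball of radius 2 r; their doubles cover. *)
Lemma ball_packing x (r s : R) : 0 < s -> s <= r ->
  exists (D : set nat) (z : nat -> X),
    [/\ forall n, D n -> ball x r (z n),
        ball x r `<=` \bigcup_(n in D) ball (z n) s &
        (\sum_(n <oo | n \in D) om (ball (z n) s) <= K%:E * om (ball x (2 * r)))%E].
Proof.
move=> s0 sr; have s20 : 0 < s / 2 by lra.
have E2 : 2 * (s / 2) = s by field.
have sub y : ball x r y -> ball y (s / 2) `<=` ball x (2 * r).
  by move=> /ballP xy; apply: subset_ball_dist; lra.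
have [|D [z [zB tD cov]]] := @metric_vitali R X om om_pos (ball x r) x (2 * r) (s / 2)
  (fun=> 0%N) s20 (doubling_fin _ _).
  by move=> y; rewrite expr0 divr1; exact: sub.
rewrite expr0 divr1 E2 in tD cov.
exists D, z; split => //.
have -> : s = 2 * (s / 2) by rewrite E2.
by apply: (@doubling_sum D z (fun=> s / 2)) => // n Dn; exact: (sub _ (zB _ Dn)).
Qed.

Lemma measure_cover (nu : {measure set (borel X) -> \bar R}) (A : set (borel X))
    (D : set nat) (F : nat -> set (borel X)) :
  measurable A -> (forall n, measurable (F n)) ->
  A `<=` \bigcup_(n in D) F n ->
  (nu A <= \sum_(n <oo | n \in D) nu (F n))%E.
Proof.
move=> mA mF; rewrite bigcup_mkcond => AF.
rewrite eseries_mkcond.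
pose G n := if n \in D then F n else set0.
have mG n : measurable (G n) by rewrite /G; case: ifP.
apply: (le_trans (@measure_sigma_subadditive _ _ _ nu A G mG mA AF)).
by apply: lee_nneseries => // n _; rewrite /G; case: ifP => _; rewrite ?measure0.
Qed.

(** A weak form of the differentiation theorem, with the loss of a factor K.
    Cover A by the doubles of disjoint balls that lie in an open set U whose
    om-measure is almost that of A: nu is at most b om on the doubles, whose
    total om-measure is at most K om(U). *)
Lemma le_measure_of_small_balls (nu : {measure set (borel X) -> \bar R})
    (A : set (borel X)) x0 (r0 s b : R) :
  measurable A -> A `<=` ball x0 r0 -> 0 < s -> 0 <= b ->
  (forall x j, A x -> (nu (ball x (s / 2 ^+ j)) <= b%:E * om (ball x (s / 2 ^+ j)))%E) ->
  (nu A <= (b * K)%:E * om A)%E.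
Proof.
move=> mA AB s0 b0 nuom.
have bK0 : 0 <= b * K by rewrite mulr_ge0.
apply/lee_addgt0Pr => e e0.
have mB : measurable (ball x0 r0 : set (borel X)) by [].
pose om' := mrestr om mB.
have om'_fin : (om' setT < +oo)%E.
  by rewrite /om' /mrestr setTI; exact: doubling_fin.
have [|U0 [oU0 AU0 leU0]] := metric_outer_regular om'_fin (e := e / (b * K + 1)) mA.
  by rewrite divr_gt0//; lra.
pose U := U0 `&` ball x0 r0.
have oU : open U by apply: openI => //; exact: open_metric_ball.
have mU : measurable (U : set (borel X)) by exact: measurable_open.
have AU : A `<=` U by move=> x Ax; split; [exact: AU0|exact: AB].
have /choice[j jP] : forall x, exists j, A x -> ball x (s / 2 ^+ j) `<=` U.
  move=> x; have [Ax|nAx] := pselect (A x); last by exists 0%N.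
  have /nbhs_ballP[d /= d0 dU] : nbhs x U.
    by move: oU; rewrite openE; apply; exact: AU.
  exists (Num.truncn (s / d)) => _; apply: subset_trans dU; apply: le_ball.
  rewrite ler_pdivrMr ?exprn_gt0// mulrC -ler_pdivrMr//.
  apply: ltW; apply: lt_le_trans (truncnS_gt _) _.
  by rewrite -natrX ler_nat ltn_expl.
(* One more halving than needed to enter U, so that the doubled balls are still
   of the form s / 2 ^+ j to which the hypothesis applies. *)
pose rho x := s / 2 ^+ (j x).+1.
have rho0 x : 0 < rho x by rewrite divr_gt0// exprn_gt0.
have rho2 x : 2 * rho x = s / 2 ^+ j x.
  by rewrite /rho exprS; field; rewrite expf_neq0.
have rhoU x : A x -> ball x (rho x) `<=` U.
  move=> Ax; apply: subset_trans (jP x Ax); apply: le_ball; rewrite -rho2.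
  by have := rho0 x; lra.
have [|D [z [zA tD cov]]] := @metric_vitali R X om om_pos A x0 r0 s
  (fun x => (j x).+1) s0 (doubling_fin _ _).
  by move=> x Ax y /(rhoU _ Ax)[].
apply: (@le_trans _ _ (\sum_(n <oo | n \in D) nu (ball (z n) (2 * rho (z n))))%E).
  by apply: measure_cover.
apply: (@le_trans _ _ (\sum_(n <oo | n \in D) b%:E * om (ball (z n) (2 * rho (z n))))%E).
  apply: lee_nneseries => // n; rewrite inE => Dn.
  by rewrite rho2; apply: nuom; exact: zA.
rewrite nneseriesZl//.
apply: (@le_trans _ _ (b%:E * (K%:E * om U))%E).
  apply: lee_wpmul2l; first by rewrite lee_fin.
  by apply: (@doubling_sum D z (rho \o z)) => // n Dn; [exact: rho0|exact: (rhoU _ (zA _ Dn))].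
rewrite muleA -EFinM.
have leU : (om U <= om A + (e / (b * K + 1))%:E)%E.
  apply: le_trans leU0 _; rewrite leeD2r//; apply: le_meas => //.
  exact: measurableI.
apply: (@le_trans _ _ ((b * K)%:E * (om A + (e / (b * K + 1))%:E))%E).
  by apply: lee_wpmul2l; rewrite ?lee_fin.
rewrite ge0_muleDr//; last by rewrite lee_fin divr_ge0//; lra.
rewrite leeD2l// -EFinM lee_fin mulrA ler_pdivrMr; last by lra.
by rewrite mulrC ler_pM2l//; lra.
Qed.

(** Calderon-Zygmund stopping: for each centre x where the average of nu exceeds
    b at some dyadic radius below r, take the largest such radius, and select
    disjoint balls by the covering lemma.  The balls of the conclusion are their
    doubles, whose averages are still at most b.  Off these balls all dyadic
    averages are at most b, which bounds nu there by differentiation. *)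
Lemma stopping_balls (nu : {measure set (borel X) -> \bar R}) x0 (r b : R) :
  0 < r -> 0 <= b ->
  (forall x, ball x0 r x -> (nu (ball x r) <= b%:E * om (ball x r))%E) ->
  exists (D : set nat) (z : nat -> X) (sg : nat -> R),
    [/\ forall n, D n -> 0 < sg n <= r,
        forall n k, D n -> 2 ^+ k * sg n <= r ->
          (nu (ball (z n) (2 ^+ k * sg n)) <= b%:E * om (ball (z n) (2 ^+ k * sg n)))%E,
        (b%:E * \sum_(n <oo | n \in D) om (ball (z n) (sg n))
          <= K%:E * nu (ball x0 (2 * r)))%E &
        forall A : set (borel X), measurable A -> A `<=` ball x0 r ->
          (forall n, D n -> A `&` ball (z n) (sg n) = set0) ->
          (nu A <= (b * K)%:E * om A)%E].
Proof.
move=> r0 b0 top.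
(* At the stopping exponent j x the average exceeds b, at smaller exponents it
   does not; the hypothesis on balls of radius r excludes j x = 0. *)
pose good x i := `[< (nu (ball x (r / 2 ^+ i)) <= b%:E * om (ball x (r / 2 ^+ i)))%E >].
pose E := [set x | ball x0 r x /\ exists i, ~~ good x i].
have /choice[j jP] : forall x, exists j, E x ->
    [/\ (0 < j)%N, ~~ good x j & forall i, (i < j)%N -> good x i].
  move=> x; have [[Bx exi]|nE] := pselect (E x); last by exists 0%N.
  case: (ex_minnP exi) => j badj minj; exists j => _; split => //.
  - rewrite lt0n; apply: contra badj => /eqP ->; apply/asboolP.
    by rewrite expr0 divr1; exact: top.
  - by move=> i ij; apply: contraLR ij => badi; rewrite -leqNgt; exact: minj.
pose rho x := r / 2 ^+ (j x).
have rho0 x : 0 < rho x by rewrite divr_gt0// exprn_gt0.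
have rho_le x : rho x <= r.
  by rewrite ler_pdivrMr ?exprn_gt0// ler_peMr ?exprn_ege1 ?ler1n// ltW.
have rhoB x : E x -> ball x (rho x) `<=` ball x0 (2 * r).
  by move=> [/ballP xr _]; apply: subset_ball_dist; have := rho_le x; lra.
have [D [z [zE tD cov]]] := @metric_vitali R X om om_pos E x0 (2 * r) r j r0
  (doubling_fin _ _) rhoB.
exists D, z, (fun n => 2 * rho (z n)); split.
- move=> n Dn; rewrite mulr_gt0//=.
  have [j0 _ _] := jP _ (zE _ Dn).
  rewrite mulrC -ler_pdivlMr// /rho; apply: ler_wpM2l; first exact: ltW.
  by rewrite lef_pV2 ?posrE ?exprn_gt0// -{1}(expr1 2) ler_eXn2l// ltr1n.
- move=> n k Dn; have [j0 _ good_lt] := jP _ (zE _ Dn).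
  have -> : 2 ^+ k * (2 * rho (z n)) = 2 ^+ k.+1 * r / 2 ^+ j (z n).
    by rewrite /rho exprS; ring.
  rewrite ler_pdivrMr ?exprn_gt0// mulrC ler_pM2l// ler_eXn2l ?ltr1n// => kj.
  have -> : r * 2 ^+ k.+1 / 2 ^+ j (z n) = r / 2 ^+ (j (z n) - k.+1).
    by rewrite -{1}(subnK kj) exprD; field; rewrite !expf_neq0.
  by apply/asboolP; apply: good_lt; rewrite ltn_subrL j0.
- rewrite -nneseriesZl//.
  apply: (@le_trans _ _ (K%:E * \sum_(n <oo | n \in D) nu (ball (z n) (rho (z n))))%E).
    rewrite -nneseriesZl//; apply: lee_nneseries => [n _ _|n].
      by rewrite mule_ge0// lee_fin.
    rewrite inE => Dn; have [_ bad _] := jP _ (zE _ Dn).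
    have {}bad : (b%:E * om (ball (z n) (rho (z n))) <= nu (ball (z n) (rho (z n))))%E.
      by rewrite ltW// ltNge; apply/negP => le; move/negP: bad; apply; apply/asboolP.
    apply: le_trans (lee_wpmul2l _ bad); rewrite ?lee_fin//.
    rewrite muleCA; apply: lee_wpmul2l; rewrite ?lee_fin//.
    by have /andP[] := om_dbl (z n) (rho0 (z n)).
  apply: lee_wpmul2l; rewrite ?lee_fin//.
  rewrite -(measure_bigcup nu D (fun n => ball (z n) (rho (z n))))//.
  apply: le_meas => //; first by apply: bigcup_measurable => n _.
  by apply: bigcup_sub => n Dn; exact: (rhoB _ (zE _ Dn)).
- move=> A mA AB disj.
  apply: (@le_measure_of_small_balls _ _ x0 r r) => // x i Ax.
  apply/asboolP; rewrite -/(good x i); apply: contrapT => /negP bad.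
  have [n Dn zx] : (\bigcup_(n in D) ball (z n) (2 * rho (z n))) x.
    by apply: cov; split; [exact: AB|exists i].
  by have := disj _ Dn; rewrite -subset0 => /(_ x); apply.
Qed.

End doubling_measures.

(** * Integrals of weights and the class A1 *)

(** The points of X and of borel X are the same but not syntactically so, and
    instance resolution distinguishes them. *)
#[local] Instance ae_filter_borel (R : realType) (X : pmetricType R)
  (mu : {measure set (borel X) -> \bar R}) :
  @Filter X (@nbhs _ (set_system X) (@almost_everywhere _ (borel X) R mu)).
Proof. exact: (@ae_filter_ringOfSetsType _ (borel X) R mu). Qed.

Section wmeas_theory.
Context {R : realType} {X : pmetricType R}.
Variable mu : {measure set (borel X) -> \bar R}.
Implicit Types (A B : set (borel X)) (h g : X -> R).

Lemma measurable_loc_integrable h :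
  loc_integrable mu h -> measurable_fun setT (h : borel X -> R).
Proof.
move=> locg; rewrite -(bigcup_metric_ball (point : X)).
apply/measurable_fun_bigcup => // n.
have /integrableP[/measurable_EFinP] : mu.-integrable (ball (point : X) n.+1%:R) (EFin \o h).
  by apply: locg; rewrite ltr0n.
by [].
Qed.

Lemma ae_not_null A : measurable A -> {ae mu, forall y, ~ A y} -> mu A = 0%E.
Proof.
move=> mA nA; apply: measure_negligible => //.
by move: nA; rewrite /almost_everywhere/=; congr (mu.-negligible _);
  apply/seteqP; split => x /=; [move=> /contrapT|move=> Ax; apply].
Qed.

Lemma wmeas_ge0 h A : (forall x, 0 <= h x) -> (0 <= wmeas mu h A)%E.
Proof. by move=> h0; apply: integral_ge0 => x _; rewrite lee_fin. Qed.

Lemma wmeas_eq0_ae h A : measurable A -> measurable_fun setT (h : borel X -> R) ->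
  (forall x, 0 <= h x) -> wmeas mu h A = 0%E -> {ae mu, forall y, A y -> h y = 0}.
Proof.
move=> mA mh h0 hA0.
have mhA : measurable_fun A (EFin \o (h : borel X -> R)).
  by apply/measurable_EFinP; exact: measurable_funTS.
have /(ae_eq_integral_abs mu mA mhA) : (\int[mu]_(x in A) `|(EFin \o h) x|)%E = 0%E.
  rewrite -[RHS]hA0; apply: eq_integral => x _ /=.
  by rewrite ger0_norm.
by apply: filterS => x /= + Ax => /(_ Ax)[].
Qed.

Lemma wmeas_gt0 h A : measurable A -> measurable_fun setT (h : borel X -> R) ->
  (forall x, 0 <= h x) -> {ae mu, forall y, A y -> 0 < h y} -> (0 < mu A)%E ->
  (0 < wmeas mu h A)%E.
Proof.
move=> mA mh h0 hpos muA; rewrite lt0e wmeas_ge0// andbT; apply/eqP => hA0.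
suff : mu A = 0%E by move=> A0; rewrite A0 ltxx in muA.
apply: ae_not_null => //.
apply: filterS2 hpos (wmeas_eq0_ae mA mh h0 hA0) => x + + Ax.
by move=> /(_ Ax) + /(_ Ax) => /[swap] ->; rewrite ltxx.
Qed.

Lemma wmeas_null h A : measurable A -> measurable_fun setT (h : borel X -> R) ->
  (forall x, 0 <= h x) -> mu A = 0%E -> wmeas mu h A = 0%E.
Proof.
move=> mA mh h0 A0.
have mhA : measurable_fun A (EFin \o (h : borel X -> R)).
  by apply/measurable_EFinP; exact: measurable_funTS.
rewrite -(integral_abs_eq0 mA mhA A0); apply: eq_integral => x _ /=.
by rewrite ger0_norm.
Qed.

Lemma le_wmeas h A B : measurable A -> measurable B ->
  measurable_fun setT (h : borel X -> R) -> (forall x, 0 <= h x) ->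
  A `<=` B -> (wmeas mu h A <= wmeas mu h B)%E.
Proof. by move=> mA mB mh h0; exact: (@le_meas _ _ (dens mu mh h0)). Qed.

Lemma le_wmeas_ae h g A : measurable A ->
  measurable_fun setT (h : borel X -> R) -> (forall x, 0 <= h x) ->
  measurable_fun setT (g : borel X -> R) -> (forall x, 0 <= g x) ->
  {ae mu, forall y, A y -> h y <= g y} -> (wmeas mu h A <= wmeas mu g A)%E.
Proof.
move=> mA mh h0 mg g0 hg; apply: ae_ge0_le_integral => //.
- by move=> x _; rewrite lee_fin.
- by apply/measurable_EFinP; exact: measurable_funTS.
- by move=> x _; rewrite lee_fin.
- by apply/measurable_EFinP; exact: measurable_funTS.
Qed.

Lemma wmeas_cst A (k : R) : measurable A -> wmeas mu (fun=> k) A = (k%:E * mu A)%E.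
Proof. by move=> mA; rewrite /wmeas integral_cst. Qed.

Lemma wmeasZ h A (k : R) : measurable A -> measurable_fun setT (h : borel X -> R) ->
  (forall x, 0 <= h x) -> 0 <= k ->
  wmeas mu (fun x => k * h x) A = (k%:E * wmeas mu h A)%E.
Proof.
move=> mA mh h0 k0; rewrite /wmeas.
under eq_integral do rewrite EFinM.
rewrite ge0_integralZl_EFin//.
- by move=> x _; rewrite lee_fin.
- by apply/measurable_EFinP; exact: measurable_funTS.
Qed.

Lemma wmeasD h g A : measurable A ->
  measurable_fun setT (h : borel X -> R) -> (forall x, 0 <= h x) ->
  measurable_fun setT (g : borel X -> R) -> (forall x, 0 <= g x) ->
  wmeas mu (fun x => h x + g x) A = (wmeas mu h A + wmeas mu g A)%E.
Proof.
move=> mA mh h0 mg g0; rewrite /wmeas.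
under eq_integral do rewrite EFinD.
rewrite ge0_integralD//.
- by move=> x _; rewrite lee_fin.
- by apply/measurable_EFinP; exact: measurable_funTS.
- by move=> x _; rewrite lee_fin.
- by apply/measurable_EFinP; exact: measurable_funTS.
Qed.

(** The positive part of h - g has integral 0 over A, while it is positive on A. *)
Lemma null_of_le_wmeas h g A : measurable A ->
  measurable_fun setT (h : borel X -> R) -> (forall x, 0 <= h x) ->
  measurable_fun setT (g : borel X -> R) -> (forall x, 0 <= g x) ->
  (wmeas mu g A < +oo)%E -> (forall y, A y -> g y < h y) ->
  (wmeas mu h A <= wmeas mu g A)%E -> mu A = 0%E.
Proof.
move=> mA mh h0 mg g0 gfin gh le.
pose k y := Num.max 0 (h y - g y).
have k0 y : 0 <= k y by rewrite le_max lexx.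
have mk : measurable_fun setT (k : borel X -> R).
  by apply: measurable_maxr => //; exact: measurable_funB.
have kE : wmeas mu h A = (wmeas mu g A + wmeas mu k A)%E.
  rewrite -wmeasD//; apply: eq_integral => x /set_mem Ax; congr EFin.
  by rewrite /k max_r ?subr_ge0 ?(ltW (gh _ Ax))//; ring.
have gfn : wmeas mu g A \is a fin_num by rewrite ge0_fin_numE// wmeas_ge0.
have kA0 : wmeas mu k A = 0%E.
  apply/eqP; rewrite eq_le wmeas_ge0// andbT.
  by move: le; rewrite kE -leeBrDl// subee.
apply: ae_not_null => //; apply: filterS (wmeas_eq0_ae mA mk k0 kA0) => x + Ax.
move=> /(_ Ax); rewrite /k max_r ?subr_ge0 ?(ltW (gh _ Ax))// => /eqP.
by rewrite subr_eq0 => /eqP hg; have := gh _ Ax; rewrite hg ltxx.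
Qed.

End wmeas_theory.

Section muckenhoupt.
Context {R : realType} {X : pmetricType R}.
Variables (mu : {measure set (borel X) -> \bar R}) (K : R).
Hypothesis K1 : 1 <= K.
Hypothesis mu_dbl : forall x r, 0 < r ->
  (mu (ball x (2 * r)) <= K%:E * mu (ball x r) < +oo)%E.
Hypothesis mu_pos : balls_positive mu.

Local Notation V := (vol mu).

Lemma mu_fin_num x r : mu (ball x r) \is a fin_num.
Proof. by rewrite ge0_fin_numE//; exact: (doubling_fin mu_dbl). Qed.

Lemma volE x r : mu (ball x r) = (V x r)%:E.
Proof. by rewrite /vol fineK// mu_fin_num. Qed.

Lemma vol_gt0 x r : 0 < r -> 0 < V x r.
Proof. by move=> r0; rewrite -lte_fin -volE; exact: mu_pos. Qed.

Lemma vol_ge0 x r : 0 <= V x r.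
Proof. by rewrite -lee_fin -volE. Qed.

Lemma le_vol x y r s : ball x r `<=` ball y s -> V x r <= V y s.
Proof. by move=> xy; rewrite -lee_fin -!volE; exact: le_meas. Qed.

Lemma vol_double x r : 0 < r -> V x (2 * r) <= K * V x r.
Proof. by move=> r0; rewrite -lee_fin EFinM -!volE; have /andP[] := mu_dbl x r0. Qed.

Lemma vol_double_iter x r k : 0 < r -> V x (2 ^+ k * r) <= K ^+ k * V x r.
Proof.
move=> r0; elim: k => [|k IH]; first by rewrite !expr0 !mul1r.
rewrite exprS -mulrA (le_trans (vol_double _ _)) ?mulr_gt0 ?exprn_gt0//.
by rewrite exprS -mulrA ler_pM2l// (lt_le_trans _ K1).
Qed.

Variable w : X -> R.
Hypothesis w_A1 : is_A1 mu w.

Lemma weight_ge0 x : 0 <= w x. Proof. by case: w_A1 => -[+ _ _] _; apply. Qed.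

Lemma weight_measurable : measurable_fun setT (w : borel X -> R).
Proof. by case: w_A1 => -[_ /measurable_loc_integrable]. Qed.

Let w0 := weight_ge0.
Let mw := weight_measurable.

Definition wvol x r : R := fine (wmeas mu w (ball x r)).

Lemma wmeas_ball_fin x r : (wmeas mu w (ball x r) < +oo)%E.
Proof.
case: w_A1 => -[_ wloc _] _.
pose s := Num.max r 1; have s0 : 0 < s by rewrite lt_max ltr01 orbT.
apply: (@le_lt_trans _ _ (wmeas mu w (ball x s))).
  by apply: le_wmeas => //; apply: le_ball; rewrite le_max lexx.
have /integrableP[_] := wloc x s s0; apply: le_lt_trans.
rewrite le_eqVlt; apply/orP; left; apply/eqP; apply: eq_integral => y _ /=.
by rewrite ger0_norm.
Qed.

Lemma wvolE x r : wmeas mu w (ball x r) = (wvol x r)%:E.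
Proof.
by rewrite /wvol fineK// ge0_fin_numE ?wmeas_ge0//; exact: wmeas_ball_fin.
Qed.

Lemma wvol_ge0 x r : 0 <= wvol x r.
Proof. by rewrite -lee_fin -wvolE; exact: wmeas_ge0. Qed.

(** The constant is enlarged to at least 1 so that it can be multiplied into
    inequalities without a sign condition. *)
Lemma A1_average : exists2 C : R, 1 <= C & forall x r, 0 < r ->
  {ae mu, forall y, ball x r y -> wvol x r / V x r <= C * w y}.
Proof.
case: w_A1 => _ [C hC]; exists (Num.max C 1); first by rewrite le_max lexx orbT.
move=> x r r0; apply: filterS (hC x r r0) => y + xy => /(_ xy).
rewrite wvolE volE inver gt_eqF ?vol_gt0// -EFinM lee_fin => /le_trans; apply.
by rewrite ler_wpM2r// le_max lexx.
Qed.

(** On a ball of positive w-measure the A1 condition bounds w from below by a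
    positive constant.  As w is not almost everywhere 0, all sufficiently large
    balls around the base point have positive w-measure. *)
Lemma weight_gt0 : {ae mu, forall y, 0 < w y}.
Proof.
have [C C1 hC] := A1_average; case: w_A1 => -[_ _ wnz] _.
have [n wn] : exists n, 0 < wvol point n.+1%:R.
  apply: contrapT => /forallNP nw; apply: wnz.
  suff h : forall n, {ae mu, forall y, ball (point : X) n.+1%:R y -> w y = 0}.
    apply: filterS (ae_foralln h) => y wy.
    have [n _] : (\bigcup_n ball (point : X) n.+1%:R) y by rewrite bigcup_metric_ball.
    exact: wy.
  move=> n; apply: wmeas_eq0_ae => //; rewrite wvolE; congr EFin.
  by apply/eqP; rewrite eq_le wvol_ge0 andbT leNgt; exact/negP.
have h : forall k, {ae mu, forall y, ball (point : X) (n + k).+1%:R y -> 0 < w y}.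
  move=> k; apply: filterS (hC point (n + k).+1%:R _); rewrite ?ltr0n// => y + py.
  move=> /(_ py); apply: contraTT; rewrite -!leNgt => wy.
  have -> : w y = 0 by apply/eqP; rewrite eq_le wy w0.
  rewrite mulr0 -ltNge divr_gt0 ?vol_gt0 ?ltr0n//.
  apply: lt_le_trans wn _; rewrite -lee_fin -!wvolE; apply: le_wmeas => //.
  by apply: le_ball; rewrite ler_nat ltnS leq_addr.
apply: filterS (ae_foralln h) => y wy.
have [k _ ky] : (\bigcup_n ball (point : X) n.+1%:R) y by rewrite bigcup_metric_ball.
by apply: (wy k); apply: le_ball ky; rewrite ler_nat ltnS leq_addl.
Qed.

Lemma wmeas_balls_positive : forall x r, 0 < r -> (0 < wmeas mu w (ball x r))%E.
Proof.
move=> x r r0; apply: wmeas_gt0 => //; last exact: mu_pos.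
by apply: filterS weight_gt0.
Qed.

(** Integrate the A1 condition of the double ball over the ball itself. *)
Lemma wmeas_doubling : exists2 Kw : R, 1 <= Kw & forall x r, 0 < r ->
  (wmeas mu w (ball x (2 * r)) <= Kw%:E * wmeas mu w (ball x r) < +oo)%E.
Proof.
have [C C1 hC] := A1_average; exists (C * K); first by rewrite mulr_ege1.
move=> x r r0; apply/andP; split; last by rewrite wvolE -EFinM ltry.
have r20 : 0 < 2 * r by rewrite mulr_gt0.
have V0 := vol_gt0 x r0; have V20 := vol_gt0 x r20.
have C0 : 0 <= C by rewrite (le_trans _ C1).
have sub : ball x r `<=` ball x (2 * r) by apply: le_ball; lra.
have : (wmeas mu (fun=> (wvol x (2 * r) / V x (2 * r))%R) (ball x r)
    <= wmeas mu (fun y => (C * w y)%R) (ball x r))%E.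
  apply: le_wmeas_ae => //.
  - by move=> y; rewrite divr_ge0 ?wvol_ge0 ?vol_ge0.
  - exact: measurable_funM.
  - by move=> y; rewrite mulr_ge0.
  - by apply: filterS (hC x (2 * r) r20) => y + xy; apply; exact: sub.
rewrite wmeas_cst// wmeasZ// !wvolE volE -!EFinM !lee_fin => h.
have h2 := vol_double x r0.
rewrite mulrAC ler_pdivrMr// in h.
rewrite -(ler_pM2r V0); apply: le_trans h _.
have := ler_wpM2l (mulr_ge0 C0 (wvol_ge0 x r)) h2; lra.
Qed.

End muckenhoupt.

(** * Complex-valued integrals *)

Section complex_integrals.
Context {R : realType} {X : pmetricType R}.
Variable mu : {measure set (borel X) -> \bar R}.
Implicit Types g : X -> R[i].

Definition cmeasurable g : Prop :=
  measurable_fun setT ((fun x => complex.Re (g x)) : borel X -> R) /\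
  measurable_fun setT ((fun x => complex.Im (g x)) : borel X -> R).

Lemma cmeasurableB g1 g2 : cmeasurable g1 -> cmeasurable g2 ->
  cmeasurable (fun x => g1 x - g2 x).
Proof.
move=> [r1 i1] [r2 i2]; split.
- rewrite (_ : (fun x => _) = (fun x => complex.Re (g1 x) - complex.Re (g2 x))).
    exact: measurable_funB.
  by apply/funext => x; case: (g1 x) (g2 x) => [? ?] [? ?].
- rewrite (_ : (fun x => _) = (fun x => complex.Im (g1 x) - complex.Im (g2 x))).
    exact: measurable_funB.
  by apply/funext => x; case: (g1 x) (g2 x) => [? ?] [? ?].
Qed.

Lemma cmeasurableM g1 g2 : cmeasurable g1 -> cmeasurable g2 ->
  cmeasurable (fun x => g1 x * g2 x).
Proof.
move=> [r1 i1] [r2 i2]; split.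
- rewrite (_ : (fun x => _) = (fun x => complex.Re (g1 x) * complex.Re (g2 x) -
    complex.Im (g1 x) * complex.Im (g2 x))).
    by apply: measurable_funB; exact: measurable_funM.
  by apply/funext => x; case: (g1 x) (g2 x) => [? ?] [? ?].
- rewrite (_ : (fun x => _) = (fun x => complex.Re (g1 x) * complex.Im (g2 x) +
    complex.Im (g1 x) * complex.Re (g2 x))).
    by apply: measurable_funD; exact: measurable_funM.
  by apply/funext => x; case: (g1 x) (g2 x) => [? ?] [? ?].
Qed.

Lemma measurable_cabs g : cmeasurable g ->
  measurable_fun setT ((fun x => cabs (g x)) : borel X -> R).
Proof.
move=> [mr mi]; rewrite (_ : (fun x => _) =
  Num.sqrt \o (fun x => complex.Re (g x) ^+ 2 + complex.Im (g x) ^+ 2)).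
  apply: measurableT_comp.
    by apply: continuous_measurable_fun; exact: sqrt_continuous.
  by apply: measurable_funD; exact: measurable_funX.
by apply/funext => x /=; rewrite cabsE.
Qed.

Definition cnorm1 g : \bar R := wmeas mu (fun x => cabs (g x)) setT.

Lemma cnorm1_integrable g : cmeasurable g -> (cnorm1 g < +oo)%E ->
  mu.-integrable setT (EFin \o ((fun x => complex.Re (g x)) : borel X -> R)) /\
  mu.-integrable setT (EFin \o ((fun x => complex.Im (g x)) : borel X -> R)).
Proof.
move=> mg goo; have [mr mi] := mg; have mc := measurable_cabs mg.
have ic : mu.-integrable setT (EFin \o ((fun x => cabs (g x)) : borel X -> R)).
  apply/integrableP; split; first exact/measurable_EFinP.
  apply: le_lt_trans goo; rewrite le_eqVlt; apply/orP; left; apply/eqP.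
  by apply: eq_integral => x _ /=; rewrite ger0_norm// cabs_ge0.
split; apply: le_integrable ic => //.
- exact/measurable_EFinP.
- by move=> x _ /=; rewrite lee_fin (ger0_norm (cabs_ge0 _)) Re_le_cabs.
- exact/measurable_EFinP.
- by move=> x _ /=; rewrite lee_fin (ger0_norm (cabs_ge0 _)) Im_le_cabs.
Qed.

Lemma cintegralB g1 g2 : cmeasurable g1 -> cmeasurable g2 ->
  (cnorm1 g1 < +oo)%E -> (cnorm1 g2 < +oo)%E ->
  cintegral mu (fun x => g1 x - g2 x) = cintegral mu g1 - cintegral mu g2.
Proof.
move=> m1 m2 /(cnorm1_integrable m1)[r1 i1] /(cnorm1_integrable m2)[r2 i2].
rewrite /cintegral -[RHS]/((_ - _) +i* (_ - _))%C; congr Complex.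
- rewrite -RintegralB//; congr (fine _); apply: eq_integral => x _.
  by case: (g1 x) (g2 x) => [? ?] [? ?].
- rewrite -RintegralB//; congr (fine _); apply: eq_integral => x _.
  by case: (g1 x) (g2 x) => [? ?] [? ?].
Qed.

(** The factor 2 comes from treating the real and imaginary parts separately. *)
Lemma cabs_cintegral g : cmeasurable g ->
  ((cabs (cintegral mu g))%:E <= 2%:E * cnorm1 g)%E.
Proof.
move=> mg; have [goo|] := ltP (cnorm1 g) +oo%E; last first.
  by rewrite leye_eq => /eqP ->; rewrite gt0_muley ?lte_fin// leey.
have [ir ii] := cnorm1_integrable mg goo.
have [mr mi] := mg; have mc := measurable_cabs mg.
have gfin : cnorm1 g \is a fin_num by rewrite ge0_fin_numE// wmeas_ge0// => x; exact: cabs_ge0.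
have bound (k : borel X -> R) : measurable_fun setT k ->
    mu.-integrable setT (EFin \o k) -> (forall x, `|k x| <= cabs (g x)) ->
    `|\int[mu]_x k x| <= fine (cnorm1 g).
  move=> mk ik kg; apply: le_trans (le_normr_Rintegral _ ik) _ => //.
  have le : (\int[mu]_x (`|k x|)%:E <= cnorm1 g)%E.
    apply: ge0_le_integral => //.
    - by apply/measurable_EFinP; exact: measurableT_comp.
    - exact/measurable_EFinP.
    - by move=> x _; rewrite lee_fin.
  apply: fine_le => //; rewrite ge0_fin_numE; first exact: le_lt_trans le _.
  by apply: integral_ge0 => x _; rewrite lee_fin.
rewrite -(fineK gfin) -EFinM lee_fin (le_trans (cabs_le_ReIm _))//= mulr2n mulrDl !mul1r.
apply: lerD; apply: bound => // x; [exact: Re_le_cabs|exact: Im_le_cabs].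
Qed.

End complex_integrals.

Section parametric_measurability.
Context {R : realType} {X : pmetricType R}.
Variable mu : {measure set (borel X) -> \bar R}.
Hypothesis mu_sfin : sigma_finite setT mu.

(** Tonelli's theorem is stated for bundled sigma-finite measures; the
    sigma-finiteness of mu is attached to this copy. *)
Definition sfin_copy of sigma_finite setT mu : set (borel X) -> \bar R := mu.

Local Notation nu := (sfin_copy mu_sfin).

HB.instance Definition _ := isMeasure.Build _ _ _ nu
  (measure0 mu) (measure_ge0 mu) (@measure_semi_sigma_additive _ _ _ mu).

HB.instance Definition _ := @Measure_isSigmaFinite.Build _ (borel X) R nu mu_sfin.

Lemma measurable_Rintegral_param (k : borel X * borel X -> R) :
  measurable_fun setT k ->
  measurable_fun setT ((fun x => \int[mu]_y k (x, y)) : borel X -> R).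
Proof.
move=> mk; rewrite /Rintegral.
have mEk : measurable_fun setT (EFin \o k) by apply/measurable_EFinP.
have mI : measurable_fun setT (fun x : borel X => \int[nu]_y (k (x, y))%:E)%E.
  rewrite (_ : (fun x => _) =
    (fubini_F nu (EFin \o k)^\+ \- fubini_F nu (EFin \o k)^\-)%E).
    apply: emeasurable_funB; apply: measurable_fun_fubini_tonelli_F => //.
    - exact: measurable_funepos.
    - exact: measurable_funeneg.
  apply/funext => x; rewrite integralE /fubini_F /=.
  by congr (_ - _)%E; apply: eq_integral => y _; rewrite ?funeposE ?funenegE.
exact: measurableT_comp mI.
Qed.

End parametric_measurability.

(** * Decay of the kernel and averages against it *)

(** With q <= 2^p, the term of degree p of the exponential series at c 2^k is a
    multiple of (2^p)^k, hence dominates q^k. *)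
Lemma expR_beats_geometric (R : realType) (c q : R) : 0 < c -> 1 <= q ->
  exists2 L : R, 0 < L & forall k, q ^+ k * expR (- (c * 2 ^+ k)) <= L.
Proof.
move=> c0 q1; pose p := Num.truncn q.
have q0 : 0 <= q by rewrite (le_trans _ q1).
have qp : q <= 2 ^+ p.+1.
  rewrite ltW// (lt_trans (truncnS_gt _))// -natrX ltr_nat.
  by rewrite -/p ltn_expl.
exists ((p.+1)`!%:R / c ^+ p.+1).
  by rewrite divr_gt0 ?exprn_gt0// ltr0n fact_gt0.
move=> k; rewrite expRN ler_pdivrMr ?expR_gt0//.
have u0 : 0 <= c * 2 ^+ k by rewrite mulr_ge0 ?exprn_ge0// ltW.
have h := expR_ge1Dxn p u0.
have f0 : 0 < (p.+1)`!%:R :> R by rewrite ltr0n fact_gt0.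
have cp0 : 0 < c ^+ p.+1 by rewrite exprn_gt0.
have {}h : (c * 2 ^+ k) ^+ p.+1 / (p.+1)`!%:R <= expR (c * 2 ^+ k).
  by apply: le_trans h; rewrite lerDr.
rewrite ler_pdivrMr// in h.
rewrite mulrAC ler_pdivlMr// mulrC; apply: le_trans (_ : c ^+ p.+1 * (2 ^+ p.+1) ^+ k <= _).
  by rewrite ler_pM2l// lerXn2r// nnegrE exprn_ge0.
by rewrite [leRHS]mulrC; apply: le_trans h; rewrite exprMn -!exprM mulnC.
Qed.

Section kernel.
Context {R : realType} {X : pmetricType R}.
Variables (mu : {measure set (borel X) -> \bar R}) (K : R).
Hypothesis mu_dbl : forall x r, 0 < r ->
  (mu (ball x (2 * r)) <= K%:E * mu (ball x r) < +oo)%E.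
Hypothesis mu_pos : balls_positive mu.
Variables (a : R -> X -> X -> R[i]) (m C c : R).
Hypotheses (m_ge2 : 2 <= m) (C_gt0 : 0 < C) (c_gt0 : 0 < c).
Hypotheses (a_meas : kernel_measurable a) (a_bound : kernel_bound mu a m C c).

Local Notation V := (vol mu).

(** In terms of the scale s = t^(1/m) the exponent of the kernel is that of
    d / s to the power m / (m - 1) >= 1, so it is at least 2^k once d >= 2^k s. *)
Lemma kernel_decay (q : R) : 1 <= q -> exists2 Q : R, 0 < Q &
  forall s x y, 0 < s -> cabs (a (s `^ m) x y) <= Q / V x s /\
    forall k, 2 ^+ k * s <= mdist x y ->
      cabs (a (s `^ m) x y) <= Q / V x s / q ^+ k.+1.
Proof.
move=> q1; have q0 : 0 < q by rewrite (lt_le_trans _ q1).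
have [L L0 hL] := expR_beats_geometric c_gt0 q1.
have m0 : 0 < m by move: m_ge2; lra.
have m1 : 0 < m - 1 by move: m_ge2; lra.
exists (C * (1 + q * L)); first by rewrite mulr_gt0// addr_gt0// mulr_gt0.
move=> s x y s0; have Vs0 : 0 < V x s by exact: (vol_gt0 mu_dbl).
have := a_bound x y (powR_gt0 m s0).
rewrite -powRrM mulfV ?gt_eqF// powRr1 ?(ltW s0)// => hs; split.
  apply: le_trans hs _; rewrite mulrAC ler_pM2r ?invr_gt0//.
  rewrite ler_wpM2l ?(ltW C_gt0)//.
  apply: (@le_trans _ _ 1); last by rewrite lerDl mulr_ge0// ltW.
  by rewrite -expR0 ler_expR oppr_le0 mulr_ge0 ?(ltW c_gt0)// divr_ge0 ?powR_ge0.
move=> k sxy; apply: le_trans hs _.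
set d := mdist x y in sxy *.
have d_ge0 : 0 <= d by exact: mdist_ge0.
have ds : 2 ^+ k <= d / s by rewrite ler_pdivlMr.
have ds1 : 1 <= d / s by apply: le_trans ds; rewrite exprn_ege1// ler1n.
have -> : d `^ (m / (m - 1)) / (s `^ m) `^ (m - 1)^-1 = (d / s) `^ (m / (m - 1)).
  rewrite -powRrM -[in LHS](divfK (lt0r_neq0 s0) d) powRM ?divr_ge0// ?(ltW s0)//.
  by rewrite mulfK// gt_eqF// powR_gt0.
have {}ds : 2 ^+ k <= (d / s) `^ (m / (m - 1)).
  apply: (le_trans ds); rewrite -[leLHS]powRr1 ?divr_ge0// ?(ltW s0)//.
  by apply: ler_powR => //; rewrite ler_pdivlMr// mul1r; lra.
have e1 : expR (- (c * (d / s) `^ (m / (m - 1)))) <= L / q ^+ k.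
  rewrite ler_pdivlMr ?exprn_gt0// mulrC; apply: le_trans (hL k).
  by rewrite ler_pM2l ?exprn_gt0// ler_expR lerN2 ler_pM2l.
apply: le_trans (_ : C / V x s * (L / q ^+ k) <= _).
  by rewrite ler_pM2l// divr_gt0.
have -> : C * (1 + q * L) / V x s / q ^+ k.+1 =
    C / V x s * (q^-1 / q ^+ k) + C / V x s * (L / q ^+ k).
  by rewrite exprS; field; rewrite !gt_eqF//= exprn_gt0.
by rewrite lerDr mulr_ge0// ?divr_ge0// ?invr_ge0 ?exprn_ge0// ltW.
Qed.

Lemma kernel_cmeasurable t x : 0 < t -> cmeasurable (fun y => a t x y).
Proof.
move=> t0; have [mr mi] := a_meas t0.
have mx := @pair1_measurable _ _ (borel X) (borel X) x.
by split; [exact: measurableT_comp mr mx|exact: measurableT_comp mi mx].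
Qed.

(** The kernel is at most the sum over k of Q / V(x, s) (2 D)^-k times the
    indicator of the ball of radius 2^k s.  The rate 2 D beats the growth D of
    the integrals of h and leaves a convergent geometric series. *)
Lemma kernel_average (D : R) : 1 <= D -> exists2 Q : R, 0 < Q &
  forall (h : X -> R) (M s : R) x, measurable_fun setT (h : borel X -> R) ->
    (forall y, 0 <= h y) -> 0 <= M -> 0 < s ->
    (forall k, wmeas mu h (ball x (2 ^+ k * s)) <= (M * D ^+ k)%:E)%E ->
    (wmeas mu (fun y => (cabs (a (s `^ m) x y) * h y)%R) setT <= (Q * M / V x s)%:E)%E.
Proof.
move=> D1; have D0 : 0 < D by rewrite (lt_le_trans _ D1).
have [|Q Q0 hQ] := @kernel_decay (2 * D); first by lra.
exists (2 * Q); first by rewrite mulr_gt0.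
move=> h M s x mh h0 M0 s0 hM.
have Vs0 : 0 < V x s by exact: (vol_gt0 mu_dbl).
have [top near_] := all_and2 (fun y => hQ s x y s0).
pose coef k := Q / V x s / (2 * D) ^+ k.
have coef0 k : 0 <= coef k by rewrite !divr_ge0 ?exprn_ge0 ?mulr_ge0// ltW.
pose F k y := ((coef k)%:E * ((EFin \o h) \_ (ball x (2 ^+ k * s))) y)%E.
have F0 k y : (0 <= F k y)%E.
  rewrite mule_ge0 ?lee_fin// patchE; case: ifP => //= _; exact: h0.
have mEh : measurable_fun setT (EFin \o (h : borel X -> R)) by apply/measurable_EFinP.
have mhB k : measurable_fun setT (((EFin \o h) \_ (ball x (2 ^+ k * s))) : borel X -> \bar R).
  apply/(measurable_restrictT _ _).1 => //; exact: measurable_funTS.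
have mF k : measurable_fun setT (F k : borel X -> \bar R).
  by apply: measurable_funeM.
have ma : measurable_fun setT ((fun y => cabs (a (s `^ m) x y)) : borel X -> R).
  by apply: measurable_cabs; apply: kernel_cmeasurable; exact: powR_gt0.
apply: (@le_trans _ _ (\int[mu]_y (\sum_(k <oo) F k y))%E).
  apply: ge0_le_integral => //.
  - by move=> y _; rewrite lee_fin mulr_ge0// cabs_ge0.
  - by apply/measurable_EFinP; exact: measurable_funM.
  - by apply: ge0_emeasurable_sum.
  - move=> y _.
    (* The smallest ball that contains y accounts for the whole kernel at y. *)
have exk : exists k, mdist x y < 2 ^+ k * s.
      exists (Num.truncn (mdist x y / s)); rewrite -ltr_pdivrMr//.
      apply: (lt_le_trans (truncnS_gt _)).
      by rewrite -natrX ler_nat ltn_expl.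
    case: (ex_minnP exk) => k yk mink.
    have ak : cabs (a (s `^ m) x y) <= coef k.
      case: k yk mink => [|k] yk mink; first by rewrite /coef expr0 divr1; exact: top.
      apply: near_; rewrite leNgt; apply/negP => yk'.
      by have := mink _ yk'; rewrite ltnn.
    apply: (@le_trans _ _ (F k y)).
      rewrite /F patchE mem_set; last exact/ballP.
      by rewrite -EFinM lee_fin ler_wpM2r.
    apply: le_trans (@nneseries_lim_ge _ (F ^~ y) xpredT 0%N k.+1 _) => //.
    by rewrite big_nat_recr//= leeDr// sume_ge0.
rewrite integral_nneseries//.
apply: (@le_trans _ _ (\sum_(k <oo) (2 * Q * M / V x s / (2 ^ k.+1)%:R)%:E)%E); last first.
  by apply: epsilon_trick0; rewrite !mulr_ge0 ?invr_ge0// ltW.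
apply: lee_nneseries => [k _ _|k _]; first exact: integral_ge0.
rewrite ge0_integralZl_EFin//; last first.
  by move=> y _; rewrite patchE; case: ifP => // _; rewrite lee_fin.
rewrite -integral_mkcond.
apply: (@le_trans _ _ ((coef k)%:E * (M * D ^+ k)%:E)%E).
  by apply: lee_wpmul2l; [rewrite lee_fin|exact: hM].
rewrite -EFinM lee_fin le_eqVlt; apply/orP; left; apply/eqP.
by rewrite /coef natrX exprMn exprS; field; rewrite ?expf_neq0 ?gt_eqF.
Qed.

End kernel.

(** * The operators on the class M *)

(** The integral of a nonnegative function is the supremum over the simple
    functions below it, hence monotone whether or not the functions are
    measurable. *)
Lemma ge0_le_integral_nonmeas d (T : measurableType d) (R : realType)
    (mu : {measure set T -> \bar R}) (f1 f2 : T -> \bar R) :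
  (forall x, 0 <= f1 x)%E -> (forall x, f1 x <= f2 x)%E ->
  (\int[mu]_x f1 x <= \int[mu]_x f2 x)%E.
Proof.
move=> f10 f12.
rewrite !ge0_integralTE//; last by move=> x; apply: le_trans (f12 x).
apply: ge_ereal_sup => _ [h hf1 <-]; apply: ereal_sup_ubound.
by exists h => //= x; apply: le_trans (f12 x); exact: hf1.
Qed.

Section class_M.
Context {R : realType} {X : pmetricType R}.
Variables (mu : {measure set (borel X) -> \bar R}) (K : R).
Hypothesis K1 : 1 <= K.
Hypothesis mu_dbl : forall x r, 0 < r ->
  (mu (ball x (2 * r)) <= K%:E * mu (ball x r) < +oo)%E.
Hypothesis mu_pos : balls_positive mu.

Local Notation V := (vol mu).

Lemma classM_cmeasurable f : classM mu f -> cmeasurable f.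
Proof.
move=> [x0 [beta [_ [[fr fi] _]]]].
by split; [exact: (measurable_loc_integrable fr)|exact: (measurable_loc_integrable fi)].
Qed.

(** From |f| <= |f|^2 / W + W.  On the ball of radius 2^k s the weight of the
    class M is at most a constant W that grows geometrically in k by doubling,
    and so does the measure of the ball. *)
Lemma classM_growth f x s : classM mu f -> 0 < s ->
  exists M D : R, [/\ 0 <= M, 1 <= D & forall k,
    (wmeas mu (fun y => cabs (f y)) (ball x (2 ^+ k * s)) <= (M * D ^+ k)%:E)%E].
Proof.
move=> fM s0; have mf := measurable_cabs (classM_cmeasurable fM).
case: fM => x0 [beta [beta0 [_]]].
set I := (\int[mu]_x _)%E => Ioo.
have W_gt0 y : 0 < (1 + mdist x0 y) `^ beta * V x0 (1 + mdist x0 y).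
  have d0 : 0 < 1 + mdist x0 y by rewrite ltr_pwDl// mdist_ge0.
  by rewrite mulr_gt0 ?powR_gt0//; exact: (vol_gt0 mu_dbl).
have I0 : (0 <= I)%E.
  by apply: integral_ge0 => y _; rewrite lee_fin divr_ge0 ?sqr_ge0 ?(ltW (W_gt0 _)).
have Ifin : I \is a fin_num by rewrite ge0_fin_numE.
(* Chosen so that 1 + d(x0, y) <= 2^k rho for y in the ball of radius 2^k s. *)
pose rho := 1 + mdist x0 x + s.
have dx0 : 0 <= mdist x0 x by exact: mdist_ge0.
have rho0 : 0 < rho by rewrite /rho; lra.
pose A := rho `^ beta * V x0 rho.
have A0 : 0 < A by rewrite mulr_gt0 ?powR_gt0//; exact: (vol_gt0 mu_dbl).
pose E := 2 `^ beta * K.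
have K0 : 0 < K by rewrite (lt_le_trans _ K1).
have twob1 : 1 <= 2 `^ beta by rewrite -[leLHS](powRr0 2) ler_powR ?ler1n// ltW.
have E1 : 1 <= E by rewrite mulr_ege1.
have E0 : 0 < E by rewrite (lt_le_trans _ E1).
have Vx0 : 0 < V x s by exact: (vol_gt0 mu_dbl).
exists (fine I + A * V x s), (E * K); split.
- by rewrite addr_ge0// ?fine_ge0// mulr_ge0// ltW.
- by rewrite mulr_ege1.
move=> k; pose W := A * E ^+ k.
have W0 : 0 < W by rewrite mulr_gt0 ?exprn_gt0.
have p2k : 1 <= 2 ^+ k :> R by rewrite exprn_ege1// ler1n.
have WW y : ball x (2 ^+ k * s) y ->
    (1 + mdist x0 y) `^ beta * V x0 (1 + mdist x0 y) <= W.
  move=> /ballP xy.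
  have d0 : 0 <= mdist x0 y by exact: mdist_ge0.
  have le : 1 + mdist x0 y <= 2 ^+ k * rho.
    have := metric_triangle x0 x y; rewrite /rho.
    have : 0 <= (2 ^+ k - 1) * (1 + mdist x0 x).
      by apply: mulr_ge0; [rewrite subr_ge0|lra].
    by move: xy; lra.
  apply: (@le_trans _ _ ((2 ^+ k * rho) `^ beta * V x0 (2 ^+ k * rho))).
    apply: ler_pM; rewrite ?powR_ge0 ?(vol_ge0 mu_dbl)//.
      apply: ge0_ler_powR => //; rewrite ?nnegrE; first exact: ltW.
        by lra.
      by rewrite mulr_ge0 ?exprn_ge0// ltW.
    by apply: (le_vol mu_dbl); exact: le_ball.
  rewrite /W /A /E powRM ?exprn_ge0 ?(ltW rho0)//.
  have -> : (2 ^+ k) `^ beta = (2 `^ beta) ^+ k.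
    by rewrite -[2 ^+ k]powR_mulrn// -powRrM mulrC powRrM powR_mulrn ?powR_ge0.
  rewrite exprMn.
  have := vol_double_iter K1 mu_dbl x0 k rho0.
  move=> /(ler_wpM2l (mulr_ge0 (exprn_ge0 k (powR_ge0 2 beta)) (powR_ge0 rho beta))).
  by move=> /le_trans; apply; rewrite le_eqVlt; apply/orP; left; apply/eqP; ring.
have mB : measurable (ball x (2 ^+ k * s) : set (borel X)) by [].
have mf2 : measurable_fun setT ((fun y => cabs (f y) ^+ 2) : borel X -> R).
  exact: measurable_funX.
have mf2W : measurable_fun setT ((fun y => W^-1 * cabs (f y) ^+ 2) : borel X -> R).
  exact: measurable_funM.
have W10 y : 0 <= W^-1 * cabs (f y) ^+ 2.
  by rewrite mulr_ge0 ?sqr_ge0// invr_ge0 ltW.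
apply: (@le_trans _ _ (wmeas mu (fun y => (W^-1 * cabs (f y) ^+ 2 + W)%R)
    (ball x (2 ^+ k * s)))).
  apply: le_wmeas_ae => //.
  - by move=> y; exact: cabs_ge0.
  - exact: measurable_funD.
  - by move=> y; rewrite addr_ge0// ltW.
  - apply: nearW => y _; set t := cabs (f y).
    have t0 : 0 <= t by exact: cabs_ge0.
    rewrite -(ler_pM2l W0) mulrDr mulrA mulfV ?gt_eqF// mul1r.
    by have := sqr_ge0 (t - W); have := mulr_ge0 (ltW W0) t0; lra.
rewrite wmeasD//; last by move=> y; exact: ltW.
rewrite wmeas_cst// (volE mu_dbl) -EFinM.
apply: (@le_trans _ _ (I + (W * V x (2 ^+ k * s))%:E)%E).
  rewrite leeD2r// /wmeas integral_mkcond; apply: ge0_le_integral_nonmeas => y.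
    by rewrite patchE; case: ifP => //= _; rewrite lee_fin.
  rewrite patchE; case: ifP => [/set_mem xy|_].
    rewrite lee_fin mulrC ler_wpM2l ?sqr_ge0// lef_pV2 ?posrE//; exact: WW.
  by rewrite lee_fin divr_ge0 ?sqr_ge0 ?(ltW (W_gt0 _)).
rewrite -(fineK Ifin) -EFinD lee_fin mulrDl.
have EK1 : 1 <= (E * K) ^+ k by rewrite exprn_ege1// mulr_ege1.
apply: lerD; first by rewrite ler_peMr// fine_ge0.
apply: (@le_trans _ _ (W * (K ^+ k * V x s))).
  by rewrite ler_pM2l//; exact: (vol_double_iter K1 mu_dbl).
by rewrite /W [(E * K) ^+ k]exprMn le_eqVlt; apply/orP; left; apply/eqP; ring.
Qed.

Lemma doubling_sigma_finite : sigma_finite setT mu.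
Proof.
exists (fun n => ball (point : X) n.+1%:R); first by rewrite bigcup_metric_ball.
by move=> n; split => //; exact: (doubling_fin mu_dbl).
Qed.

Variables (a : R -> X -> X -> R[i]) (m C c : R).
Hypotheses (m_ge2 : 2 <= m) (C_gt0 : 0 < C) (c_gt0 : 0 < c).
Hypotheses (a_meas : kernel_measurable a) (a_bound : kernel_bound mu a m C c).

Lemma opA_cmeasurable t f : 0 < t -> cmeasurable f -> cmeasurable (opA mu a t f).
Proof.
move=> t0 [fr fi]; have [ar ai] := a_meas t0.
have fr2 : measurable_fun setT (fun p : borel X * borel X => complex.Re (f p.2)).
  exact: (measurableT_comp fr measurable_snd).
have fi2 : measurable_fun setT (fun p : borel X * borel X => complex.Im (f p.2)).
  exact: (measurableT_comp fi measurable_snd).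
split.
- rewrite (_ : (fun x => _) = (fun x => \int[mu]_y
    (complex.Re (a t x y) * complex.Re (f y) - complex.Im (a t x y) * complex.Im (f y)))).
    apply: (@measurable_Rintegral_param R X mu doubling_sigma_finite
      (fun p => complex.Re (a t p.1 p.2) *
      complex.Re (f p.2) - complex.Im (a t p.1 p.2) * complex.Im (f p.2))).
    by apply: measurable_funB; exact: measurable_funM.
  apply/funext => x; rewrite /opA /cintegral /=; congr (fine _).
  by apply: eq_integral => y _; case: (a t x y) (f y) => [? ?] [? ?].
- rewrite (_ : (fun x => _) = (fun x => \int[mu]_y
    (complex.Re (a t x y) * complex.Im (f y) + complex.Im (a t x y) * complex.Re (f y)))).
    apply: (@measurable_Rintegral_param R X mu doubling_sigma_finite
      (fun p => complex.Re (a t p.1 p.2) *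
      complex.Im (f p.2) + complex.Im (a t p.1 p.2) * complex.Re (f p.2))).
    by apply: measurable_funD; exact: measurable_funM.
  apply/funext => x; rewrite /opA /cintegral /=; congr (fine _).
  by apply: eq_integral => y _; case: (a t x y) (f y) => [? ?] [? ?].
Qed.

(** The time is s^m, that is t_B for a ball of radius s. *)
Definition osc f s y : R := cabs (f y - opA mu a (s `^ m) f y).

Definition kernel_int s (h : X -> R) x : \bar R :=
  wmeas mu (fun y => cabs (a (s `^ m) x y) * h y) setT.

Lemma classM_kernel_int f s x : classM mu f -> 0 < s ->
  (kernel_int s (fun y => cabs (f y)) x < +oo)%E.
Proof.
move=> fM s0; have [M [D [M0 D1 hMD]]] := classM_growth x fM s0.
have [Q Q0 hQ] := kernel_average mu_dbl mu_pos m_ge2 C_gt0 c_gt0 a_meas a_bound D1.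
apply: le_lt_trans (hQ _ M s x _ _ M0 s0 hMD) (ltry _).
- by apply: measurable_cabs; exact: classM_cmeasurable fM.
- by move=> y; exact: cabs_ge0.
Qed.

(** Linearity of A_(s^m), once the two integrals involved converge absolutely. *)
Lemma opA_oscillation f s r x : classM mu f -> 0 < s -> 0 < r ->
  (kernel_int s (osc f r) x < +oo)%E ->
  opA mu a (s `^ m) (opA mu a (r `^ m) f) x = opA mu a (s `^ m) f x -
    cintegral mu (fun y => a (s `^ m) x y * (f y - opA mu a (r `^ m) f y)).
Proof.
move=> fM s0 r0 fin1; have mf := classM_cmeasurable fM.
have ma := kernel_cmeasurable a_meas x (powR_gt0 m s0).
have mA := opA_cmeasurable (powR_gt0 m r0) mf.
have cn g : cnorm1 mu (fun y => a (s `^ m) x y * g y) =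
    kernel_int s (fun y => cabs (g y)) x.
  by rewrite /cnorm1 /kernel_int; congr (wmeas _ _ _); apply/funext => y; rewrite cabsM.
rewrite -cintegralB ?cn//.
- by congr (cintegral _ _); apply/funext => y; rewrite mulrBr subKr.
- exact: (cmeasurableM ma mf).
- exact: (cmeasurableM ma (cmeasurableB mf mA)).
- exact: classM_kernel_int.
Qed.

(** Both compositions of A_(s^m) and A_(r^m) are expanded by [opA_oscillation];
    as they agree at x, the difference of A_(s^m) f and A_(r^m) f is the
    difference of the two integrals of the oscillations. *)
Lemma opA_difference f s r x : classM mu f -> 0 < s -> 0 < r ->
  opA mu a (s `^ m) (opA mu a (r `^ m) f) x =
    opA mu a (r `^ m) (opA mu a (s `^ m) f) x ->
  (kernel_int s (osc f r) x < +oo)%E -> (kernel_int r (osc f s) x < +oo)%E ->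
  ((cabs (opA mu a (s `^ m) f x - opA mu a (r `^ m) f x))%:E <=
    2%:E * kernel_int s (osc f r) x + 2%:E * kernel_int r (osc f s) x)%E.
Proof.
move=> fM s0 r0 comm fs fr; have mf := classM_cmeasurable fM.
have mA t : 0 < t -> cmeasurable (fun y => f y - opA mu a (t `^ m) f y).
  move=> t0; apply: (cmeasurableB mf).
  exact: (opA_cmeasurable (powR_gt0 m t0) mf).
have cn t u : cnorm1 mu (fun y => a (t `^ m) x y * (f y - opA mu a (u `^ m) f y)) =
    kernel_int t (osc f u) x.
  by rewrite /cnorm1 /kernel_int; congr (wmeas _ _ _); apply/funext => y; rewrite cabsM.
have bound t u : 0 < t -> 0 < u -> ((cabs (cintegral mu
    (fun y => a (t `^ m) x y * (f y - opA mu a (u `^ m) f y))))%:E <=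
    2%:E * kernel_int t (osc f u) x)%E.
  move=> t0 u0; rewrite -cn; apply: cabs_cintegral.
  exact: (cmeasurableM (kernel_cmeasurable a_meas x (powR_gt0 m t0)) (mA u u0)).
move: comm; rewrite (opA_oscillation fM s0 r0 fs) (opA_oscillation fM r0 s0 fr).
have triangle (P Q Is Ir : R[i]) (u v : \bar R) : P - Is = Q - Ir ->
    ((cabs Is)%:E <= u)%E -> ((cabs Ir)%:E <= v)%E ->
    ((cabs (P - Q))%:E <= u + v)%E.
  move=> e hu hv; have -> : P - Q = Is - Ir by rewrite -[P](subrK Is) e; ring.
  apply: (@le_trans _ _ ((cabs Is)%:E + (cabs Ir)%:E)%E); last exact: leeD.
  by rewrite -EFinD lee_fin (le_trans (cabsD _ _))// cabsN.
move=> comm.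
exact: (triangle _ _ _ _ _ _ comm (bound s r s0 r0) (bound r s r0 s0)).
Qed.

End class_M.

(** * Oscillations at comparable and at different scales *)

Section oscillation.
Context {R : realType} {X : pmetricType R}.
Variables (mu : {measure set (borel X) -> \bar R}) (K : R).
Hypothesis K1 : 1 <= K.
Hypothesis mu_dbl : forall x r, 0 < r ->
  (mu (ball x (2 * r)) <= K%:E * mu (ball x r) < +oo)%E.
Hypothesis mu_pos : balls_positive mu.
Variables (a : R -> X -> X -> R[i]) (m C c : R).
Hypotheses (m_ge2 : 2 <= m) (C_gt0 : 0 < C) (c_gt0 : 0 < c).
Hypotheses (a_meas : kernel_measurable a) (a_bound : kernel_bound mu a m C c).
Hypothesis a_comm : operators_commute mu a.
Variables (w : X -> R) (Cw Kw : R).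
Hypotheses (w_A1 : is_A1 mu w) (Cw1 : 1 <= Cw) (Kw1 : 1 <= Kw).
Hypothesis w_avg : forall x r, 0 < r ->
  {ae mu, forall y, ball x r y -> wvol mu w x r / vol mu x r <= Cw * w y}.
Hypothesis w_dbl : forall x r, 0 < r ->
  (wmeas mu w (ball x (2 * r)) <= Kw%:E * wmeas mu w (ball x r) < +oo)%E.
Variables (f : X -> R[i]) (N : R).
Hypotheses (fM : classM mu f) (N_ge0 : 0 <= N).
Hypothesis bmo_le : forall x r, 0 < r ->
  (wmeas mu (osc mu a m f r) (ball x r) <= (N * wvol mu w x r)%:E)%E.

Local Notation V := (vol mu).
Local Notation W := (wvol mu w).
Local Notation h := (osc mu a m f).
Local Notation Aop s := (opA mu a (s `^ m)).

Let w0 : forall x, 0 <= w x := weight_ge0 w_A1.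
Let mw : measurable_fun setT (w : borel X -> R) := weight_measurable w_A1.
Let om : {measure set (borel X) -> \bar R} := dens mu mw w0.

Let w_pos : balls_positive om := wmeas_balls_positive mu_dbl mu_pos w_A1.

Let K0 : 0 <= K. Proof. exact: le_trans K1. Qed.
Let Kw0 : 0 <= Kw. Proof. exact: le_trans Kw1. Qed.

Lemma osc_ge0 s y : 0 <= h s y. Proof. exact: cabs_ge0. Qed.

Lemma measurable_osc s : 0 < s -> measurable_fun setT (h s : borel X -> R).
Proof.
move=> s0; have mf := classM_cmeasurable fM.
have mA := opA_cmeasurable mu_dbl a_meas (powR_gt0 m s0) mf.
exact: (measurable_cabs (cmeasurableB mf mA)).
Qed.

Lemma le_wvol x y r s : ball x r `<=` ball y s -> W x r <= W y s.
Proof.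
move=> xy; rewrite -lee_fin -!(wvolE w_A1).
exact: (le_wmeas mu (measurable_metric_ball x r) (measurable_metric_ball y s) mw w0 xy).
Qed.

Lemma wvol_double_iter x r k : 0 < r -> W x (2 ^+ k * r) <= Kw ^+ k * W x r.
Proof. exact: (@vol_double_iter R X om Kw Kw1 w_dbl x r k). Qed.

(** Pack the ball with balls of radius s, on which the norm bounds h s. *)
Lemma osc_large_ball x r s : 0 < s -> s <= r ->
  (wmeas mu (h s) (ball x r) <= (Kw * N * W x (2 * r))%:E)%E.
Proof.
move=> s0 sr; have mhs := measurable_osc s0.
have [D [z [_ cov sumD]]] := @ball_packing R X om Kw Kw1 w_dbl w_pos x r s s0 sr.
apply: le_trans (@measure_cover R X (dens mu mhs (osc_ge0 s)) (ball x r) D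
  (fun n => ball (z n) s) (measurable_metric_ball _ _)
  (fun n => measurable_metric_ball _ _) cov) _.
apply: (@le_trans _ _ (\sum_(n <oo | n \in D) N%:E * om (ball (z n) s))%E).
  apply: lee_nneseries => [n _ _|n _]; first exact: measure_ge0.
  by apply: le_trans (bmo_le (z n) s0) _; rewrite EFinM -(wvolE w_A1).
rewrite nneseriesZl; last by move=> n _; exact: measure_ge0.
apply: (@le_trans _ _ (N%:E * (Kw%:E * om (ball x (2 * r))))%E).
  by apply: lee_wpmul2l; rewrite ?lee_fin.
rewrite (_ : om _ = (W x (2 * r))%:E); last exact: (wvolE w_A1).
by rewrite -!EFinM lee_fin mulrA (mulrC N).
Qed.

(** By [kernel_average] the integral is at most a multiple of
    M W(z, s) / V(z, s), and the A1 condition bounds this quotient by a multiple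
    of w almost everywhere on the ball. *)
Lemma kernel_int_le_weight : exists2 Q : R, 0 < Q &
  forall (H : X -> R) (M s : R) z, measurable_fun setT (H : borel X -> R) ->
    (forall y, 0 <= H y) -> 0 <= M -> 0 < s ->
    (forall k, wmeas mu H (ball z (2 ^+ k.+1 * s)) <= (M * W z (2 ^+ k.+2 * s))%:E)%E ->
    {ae mu, forall y, ball z s y -> (kernel_int mu a m s H y <= (Q * M * w y)%:E)%E}.
Proof.
have [Q Q0 hQ] := kernel_average mu_dbl mu_pos m_ge2 C_gt0 c_gt0 a_meas a_bound Kw1.
have Kp : 0 < K by rewrite (lt_le_trans _ K1).
have Kwp : 0 < Kw by rewrite (lt_le_trans _ Kw1).
have Cwp : 0 < Cw by rewrite (lt_le_trans _ Cw1).
exists (Q * Kw ^+ 2 * K * Cw); first by rewrite !mulr_gt0 ?exprn_gt0.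
move=> H M s z mH H0 M0 s0 hH; apply: filterS (w_avg z s0) => y avg zy.
have {}avg := avg zy; move/ballP: (zy) => dzy.
have Vy := vol_gt0 mu_dbl mu_pos y s0; have Vz := vol_gt0 mu_dbl mu_pos z s0.
have VV : V z s <= K * V y s.
  apply: le_trans (vol_double mu_dbl y s0); apply: (le_vol mu_dbl).
  by apply: subset_ball_dist; rewrite metric_sym; lra.
pose M' := M * (Kw ^+ 2 * W z s).
have M'0 : 0 <= M' by rewrite !mulr_ge0 ?exprn_ge0 ?(wvol_ge0 w_A1).
have growth k : (wmeas mu H (ball y (2 ^+ k * s)) <= (M' * Kw ^+ k)%:E)%E.
  have sub : ball y (2 ^+ k * s) `<=` ball z (2 ^+ k.+1 * s).
    apply: subset_ball_dist; rewrite exprS.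
    have : 1 * s <= 2 ^+ k * s by rewrite ler_pM2r// exprn_ege1// ler1n.
    by lra.
  apply: (le_trans (le_wmeas mu (measurable_metric_ball _ _)
    (measurable_metric_ball _ _) mH H0 sub)).
  apply: (le_trans (hH k)); rewrite lee_fin /M' -mulrA ler_wpM2l//.
  apply: (le_trans (wvol_double_iter z k.+2 s0)).
  by rewrite 2![in leLHS]exprS expr2; lra.
apply: (le_trans (hQ H M' s y mH H0 M'0 s0 growth)); rewrite lee_fin.
rewrite ler_pdivrMr// /M'.
rewrite ler_pdivrMr// in avg.
have h1 : W z s <= Cw * w y * (K * V y s).
  by apply: (le_trans avg); rewrite ler_wpM2l// mulr_ge0// ltW.
have := ler_wpM2l (mulr_ge0 (mulr_ge0 (ltW Q0) M0) (exprn_ge0 2 Kw0)) h1.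
by lra.
Qed.

(** Only the balls of radius at most r around z are known to have small
    averages of h r; larger balls are treated by [osc_large_ball], as are all
    the balls that occur for h s at scale r. *)
Lemma osc_comparison : exists2 Q : R, 0 < Q & forall z (s r b : R),
  0 < s -> s <= r -> 0 <= b ->
  (forall k, 2 ^+ k * s <= r ->
    (wmeas mu (h r) (ball z (2 ^+ k * s)) <= (b * W z (2 ^+ k * s))%:E)%E) ->
  {ae mu, forall y, ball z s y -> h r y <= h s y + Q * (b + N) * w y}.
Proof.
have [Q Q0 hQ] := kernel_int_le_weight.
have Kwp : 0 < Kw by rewrite (lt_le_trans _ Kw1).
exists (4 * Q * Kw); first by rewrite !mulr_gt0.
move=> z s r b s0 sr b0 small.
have arith u : 0 <= u -> 2 * (Q * (b + Kw * N) * u) + 2 * (Q * (Kw * N) * u)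
    <= 4 * Q * Kw * (b + N) * u.
  move=> u0; have Qbu : 0 <= Q * (b * u).
    by apply: mulr_ge0; [exact: ltW|exact: mulr_ge0].
  have := ler_wpM2l Qbu Kw1; lra.
have r0 : 0 < r by exact: lt_le_trans sr.
have mhs := measurable_osc s0; have mhr := measurable_osc r0.
have KN0 : 0 <= Kw * N by rewrite mulr_ge0.
have grow_r k : (wmeas mu (h r) (ball z (2 ^+ k.+1 * s)) <=
    ((b + Kw * N) * W z (2 ^+ k.+2 * s))%:E)%E.
  have p0 : 0 < 2 ^+ k.+1 * s by rewrite mulr_gt0 ?exprn_gt0.
  have [le|lt] := leP (2 ^+ k.+1 * s) r.
    apply: (le_trans (small _ le)); rewrite lee_fin.
    apply: (@le_trans _ _ (b * W z (2 ^+ k.+2 * s))).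
      rewrite ler_wpM2l//; apply: le_wvol; apply: le_ball.
      by rewrite [in leRHS]exprS -mulrA; lra.
    by rewrite ler_wpM2r ?(wvol_ge0 w_A1)//; lra.
  apply: (le_trans (osc_large_ball z r0 (ltW lt))); rewrite lee_fin.
  by rewrite mulrA -exprS ler_wpM2r ?(wvol_ge0 w_A1)//; lra.
have grow_s k : (wmeas mu (h s) (ball z (2 ^+ k.+1 * r)) <=
    (Kw * N * W z (2 ^+ k.+2 * r))%:E)%E.
  have le : s <= 2 ^+ k.+1 * r.
    apply: (le_trans sr); rewrite ler_peMl ?exprn_ege1 ?ler1n//; exact: ltW.
  by apply: (le_trans (osc_large_ball z s0 le)); rewrite mulrA -exprS.
have bKN0 : 0 <= b + Kw * N by rewrite addr_ge0.
have aes := hQ (h r) (b + Kw * N) s z mhr (osc_ge0 r) bKN0 s0 grow_r.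
have aer := hQ (h s) (Kw * N) r z mhs (osc_ge0 s) KN0 r0 grow_s.
apply: filterS3 aes aer (a_comm (powR_gt0 m s0) (powR_gt0 m r0) fM).
move=> y ks kr comm zy; have {}ks := ks zy.
have {}kr : (kernel_int mu a m r (h s) y <= (Q * (Kw * N) * w y)%:E)%E.
  by apply: kr; exact: le_ball zy.
have fs := le_lt_trans ks (ltry _); have fr := le_lt_trans kr (ltry _).
have := opA_difference K1 mu_dbl mu_pos m_ge2 C_gt0 c_gt0 a_meas a_bound
  fM s0 r0 comm fs fr.
move=> /le_trans /(_ (leeD (lee_wpmul2l _ ks) (lee_wpmul2l _ kr))).
rewrite -!EFinM -EFinD !lee_fin => /(_ (ler0n _ _) (ler0n _ _)) diff.
have tri (P p q : R[i]) : cabs (P - q) <= cabs (P - p) + cabs (p - q).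
  by have := cabsD (P - p) (p - q); rewrite addrA subrK.
apply: (le_trans (tri (f y) (Aop s f y) (Aop r f y))).
rewrite lerD2l; apply: (le_trans diff).
exact: arith (w0 y).
Qed.

End oscillation.

(** * The good-lambda induction *)

Section good_lambda.
Context {R : realType} {X : pmetricType R}.
Variables (mu : {measure set (borel X) -> \bar R}) (w : X -> R) (Kw : R).
Hypotheses (w_A1 : is_A1 mu w) (Kw1 : 1 <= Kw).
Hypothesis w_dbl : forall x r, 0 < r ->
  (wmeas mu w (ball x (2 * r)) <= Kw%:E * wmeas mu w (ball x r) < +oo)%E.
Hypothesis w_pos : forall x r, 0 < r -> (0 < wmeas mu w (ball x r))%E.
Variables (h : R -> X -> R) (N Q : R).
Hypotheses (N_gt0 : 0 < N) (Q_gt0 : 0 < Q).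
Hypothesis h_ge0 : forall s y, 0 <= h s y.
Hypothesis mh : forall s, 0 < s -> measurable_fun setT (h s : borel X -> R).

Local Notation W := (wvol mu w).

Hypothesis h_ball : forall x r, 0 < r ->
  (wmeas mu (h r) (ball x r) <= (N * W x r)%:E)%E.
Hypothesis h_large_ball : forall x r s, 0 < s -> s <= r ->
  (wmeas mu (h s) (ball x r) <= (Kw * N * W x (2 * r))%:E)%E.
Hypothesis h_comparison : forall z (s r b : R), 0 < s -> s <= r -> 0 <= b ->
  (forall k, 2 ^+ k * s <= r ->
    (wmeas mu (h r) (ball z (2 ^+ k * s)) <= (b * W z (2 ^+ k * s))%:E)%E) ->
  {ae mu, forall y, ball z s y -> h r y <= h s y + Q * (b + N) * w y}.

Let w0 : forall x, 0 <= w x := weight_ge0 w_A1.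
Let mw : measurable_fun setT (w : borel X -> R) := weight_measurable w_A1.
Let om : {measure set (borel X) -> \bar R} := dens mu mw w0.

Lemma le_wmeas_ae_subset (A B : set (borel X)) : measurable A -> measurable B ->
  {ae mu, forall y, A y -> B y} -> (wmeas mu w A <= wmeas mu w B)%E.
Proof.
move=> mA mB AB.
have mAB : measurable (A `\` B) by exact: measurableD.
have null : mu (A `\` B) = 0%E.
  by apply: ae_not_null => //; apply: filterS AB => y AB [Ay By]; exact: By (AB Ay).
apply: (@le_trans _ _ (om (B `|` (A `\` B)))).
  apply: (le_meas om) => //; first exact: measurableU.
  by move=> y Ay; have [By|By] := pselect (B y); [left|right].
apply: (le_trans (measureU2 om mB mAB)).
rewrite -[leRHS]adde0; apply: leeD; first exact: lexx.
rewrite le_eqVlt; apply/orP; left; apply/eqP.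
exact: (wmeas_null mAB mw w0 null).
Qed.

(** Comparing h r with lam w instead of the quotient h r / w with lam keeps the
    triangle inequality usable and is meaningful where w vanishes. *)
Definition exceedance r lam (y : X) : Prop := lam * w y < h r y.

Lemma measurable_exceedance x r lam : 0 < r ->
  measurable ([set y | ball x r y /\ exceedance r lam y] : set (borel X)).
Proof.
move=> r0; apply: measurableI => //.
have mlt : measurable_fun setT (fun y : borel X => lam * w y < h r y).
  apply: measurable_fun_ltr; last exact: mh.
  by apply: measurable_funM => //; exact: mw.
have := mlt measurableT [set true] I; rewrite setTI.
by congr (measurable _); apply/seteqP; split => y /=.
Qed.


(** In units of N.  The factor Kw^4 pays for one doubling in [stopping_balls], one
    in [h_large_ball] and two to come back from radius 4 r to r; the factor 2
    halves the measure. *)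
Definition good_level : R := 2 * Kw ^+ 4.
(** The first summand is the bound off the stopping balls, the second
    is the cost of the change of scale on them. *)
Definition good_step : R := (good_level * Kw + Q * (good_level + 1)) * N.

(** Up to null sets, exceeding level n + 1 at scale r happens on the stopping
    balls only, and there it implies exceeding level n at the scale of the
    stopping ball, to which the induction hypothesis applies. *)
Lemma exceedance_decay n x r lam : 0 < r -> good_step * n%:R <= lam ->
  (wmeas mu w [set y | ball x r y /\ exceedance r lam y] <=
    (W x r / 2 ^+ n)%:E)%E.
Proof.
have Kw0 : 0 < Kw by rewrite (lt_le_trans _ Kw1).
have L0 : 0 < good_level by rewrite mulr_gt0// exprn_gt0.
elim: n x r lam => [|n IH] x r lam r0 lamn.
  rewrite expr0 divr1 -(wvolE w_A1); apply: (le_meas om).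
  - exact: measurable_exceedance.
  - exact: measurable_metric_ball.
  - by move=> y [].
have mhr := mh r0.
pose nu : {measure set (borel X) -> \bar R} := dens mu mhr (h_ge0 r).
pose b := good_level * N.
have b0 : 0 < b by rewrite mulr_gt0.
have top y : ball x r y -> (nu (ball y r) <= b%:E * om (ball y r))%E.
  move=> _; apply: (le_trans (h_ball y r0)).
  rewrite (_ : om (ball y r) = (W y r)%:E); last exact: (wvolE w_A1).
  rewrite -EFinM lee_fin ler_wpM2r ?(wvol_ge0 w_A1)// /b ler_peMl ?(ltW N_gt0)//.
  rewrite /good_level; have : 1 <= Kw ^+ 4 by rewrite exprn_ege1.
  by lra.
have [D [z [sg [sgP growth sumD good]]]] :=
  @stopping_balls R X om Kw Kw1 w_dbl w_pos nu x r b r0 (ltW b0) top.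
pose A0 : set (borel X) := [set y | ball x r y /\ exceedance r lam y].
have mA0 : measurable A0 by exact: measurable_exceedance.
pose U : set (borel X) := \bigcup_(n in D) ball (z n) (sg n).
have mU : measurable U.
  by apply: bigcup_measurable => i _; exact: measurable_metric_ball.
have step0 : 0 <= good_step.
  by rewrite mulr_ge0 ?(ltW N_gt0)// addr_ge0// mulr_ge0// ?addr_ge0// ltW.
have lam0 : b * Kw <= lam.
  apply: le_trans lamn; apply: (@le_trans _ _ good_step).
    rewrite /good_step /b mulrAC ler_pM2r// lerDl mulr_ge0 ?(ltW Q_gt0)//.
    by rewrite addr_ge0 ?(ltW L0).
  by rewrite ler_peMr// ler1n.
have mA : measurable (A0 `\` U) by exact: measurableD.
(* Off U the integral of h r is at most that of b Kw w, although h r exceeds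
   b Kw w on A0. *)
have nullA : mu (A0 `\` U) = 0%E.
  have bKw0 : 0 <= b * Kw by rewrite mulr_ge0// ltW.
  apply: (@null_of_le_wmeas R X mu (h r) (fun y => b * Kw * w y)) => //.
  - by apply: measurable_funM => //; exact: mw.
  - by move=> y; rewrite mulr_ge0.
  - rewrite wmeasZ//; apply: lte_mul_pinfty; rewrite ?lee_fin//.
    apply: le_lt_trans (wmeas_ball_fin w_A1 x r).
    by apply: (le_meas om) => // y [[]].
  - move=> y [[_ ey] _]; apply: le_lt_trans ey.
    by rewrite ler_wpM2r.
  - rewrite wmeasZ//; apply: good => //; first by move=> y [[]].
    move=> i Di; rewrite -subset0 => y [[_ Uy] zy]; apply: Uy.
    by exists i.
have omA : wmeas mu w (A0 `\` U) = 0%E by exact: wmeas_null.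
have piece i : D i -> (om (A0 `&` ball (z i) (sg i)) <=
    (2 ^+ n)^-1%:E * om (ball (z i) (sg i)))%E.
  move=> Di; have /andP[sg0 sgr] := sgP i Di.
  apply: (@le_trans _ _ (wmeas mu w
      [set y | ball (z i) (sg i) y /\ exceedance (sg i) (lam - good_step) y])).
    apply: le_wmeas_ae_subset.
    - by apply: measurableI => //; exact: measurable_metric_ball.
    - exact: measurable_exceedance.
    have small k : 2 ^+ k * sg i <= r -> (wmeas mu (h r)
        (ball (z i) (2 ^+ k * sg i)) <= (b * W (z i) (2 ^+ k * sg i))%:E)%E.
      by move=> kr; rewrite EFinM -(wvolE w_A1); exact: growth.
    apply: filterS (h_comparison sg0 sgr (ltW b0) small) => y cmp [[_ ey] zy].
    split => //; have {}cmp := cmp zy; rewrite /exceedance.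
    have := lt_le_trans ey cmp; rewrite -ltrBlDr -mulrBl; apply: le_lt_trans.
    rewrite ler_wpM2r// lerD2l lerN2 /good_step /b.
    have : 0 <= good_level * Kw * N by rewrite !mulr_ge0// ltW.
    by lra.
  apply: (le_trans (IH (z i) (sg i) (lam - good_step) sg0 _)).
    by move: lamn; rewrite -natr1 mulrDr mulr1; lra.
  rewrite (_ : om (ball _ _) = (W (z i) (sg i))%:E); last exact: (wvolE w_A1).
  by rewrite -EFinM mulrC.
have sum_half : (\sum_(i <oo | i \in D) om (ball (z i) (sg i)) <= (W x r / 2)%:E)%E.
  rewrite -(lee_pmul2l (x := b%:E)) ?lte_fin//; apply: (le_trans sumD).
  apply: (@le_trans _ _ (Kw%:E * (Kw * N * W x (2 * (2 * r)))%:E)%E).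
    apply: lee_wpmul2l; first by rewrite lee_fin ltW.
    by apply: h_large_ball => //; lra.
  have W4 : W x (2 * (2 * r)) <= Kw ^+ 2 * W x r.
    have := @vol_double_iter R X om Kw Kw1 w_dbl x r 2 r0.
    by rewrite {1}expr2 -mulrA.
  rewrite -!EFinM lee_fin /b /good_level.
  have := ler_wpM2l (mulr_ge0 (mulr_ge0 (ltW Kw0) (ltW Kw0)) (ltW N_gt0)) W4.
  by lra.
have -> : W x r / 2 ^+ n.+1 = (2 ^+ n)^-1 * (W x r / 2).
  by rewrite exprS; field; rewrite expf_neq0.
rewrite EFinM; apply: (@le_trans _ _ ((2 ^+ n)^-1%:E *
    \sum_(i <oo | i \in D) om (ball (z i) (sg i)))%E); last first.
  by apply: lee_wpmul2l => //; rewrite lee_fin invr_ge0 exprn_ge0.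
rewrite -nneseriesZl//.
apply: (@le_trans _ _ (om (A0 `&` U))).
  apply: le_wmeas_ae_subset => //; first exact: measurableI.
  exists (A0 `\` U); split => // y /= /not_implyP[Ay nAU].
  by split => // Uy; apply: nAU.
apply: (@le_trans _ _ (\sum_(i <oo | i \in D) om (A0 `&` ball (z i) (sg i)))%E).
  apply: (@measure_cover R X om (A0 `&` U) D (fun i => A0 `&` ball (z i) (sg i))).
  - exact: measurableI.
  - by move=> i; apply: measurableI => //; exact: measurable_metric_ball.
  - by move=> y [Ay [i Di zy]]; exists i.
by apply: lee_nneseries => // i; rewrite inE; exact: piece.
Qed.

End good_lambda.

(** * The John-Nirenberg inequality *)

Section bmo_norm_facts.
Context {R : realType} {X : pmetricType R}.
Variables (mu : {measure set (borel X) -> \bar R}) (a : R -> X -> X -> R[i]) (m : R).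
Variables (w : X -> R) (f : X -> R[i]).
Hypotheses (w_A1 : is_A1 mu w).
Hypothesis w_pos : forall x r, 0 < r -> (0 < wmeas mu w (ball x r))%E.

Lemma bmo_norm_ge0 : (0 <= bmo_norm mu a m w f)%E.
Proof.
apply: (@le_trans _ _ (wmeas mu (osc mu a m f 1) (ball (point : X) 1) /
    wmeas mu w (ball (point : X) 1))%E).
  rewrite mule_ge0 ?inve_ge0 ?wmeas_ge0//; first by move=> y; exact: osc_ge0.
  exact: weight_ge0 w_A1.
by apply: ereal_sup_ubound; exists (point, 1) => /=.
Qed.

Lemma osc_le_bmo_norm : (bmo_norm mu a m w f < +oo)%E -> forall x r, 0 < r ->
  (wmeas mu (osc mu a m f r) (ball x r) <=
    (fine (bmo_norm mu a m w f) * wvol mu w x r)%:E)%E.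
Proof.
move=> noo x r r0.
have W0 : 0 < wvol mu w x r.
  by rewrite -lte_fin -(wvolE w_A1); exact: w_pos.
rewrite EFinM fineK; last by rewrite ge0_fin_numE// bmo_norm_ge0.
have inv : ((wmeas mu w (ball x r))^-1 = (wvol mu w x r)^-1%:E)%E.
  by rewrite (wvolE w_A1) inver gt_eqF.
rewrite -lee_pdivrMr// -inv.
by apply: ereal_sup_ubound; exists (x, r).
Qed.

End bmo_norm_facts.

Theorem theorem3p6 (R : realType) (X : pmetricType R)
    (mu : {measure set (borel X) -> \bar R})
    (mu_doubling : doubling mu) (mu_balls : balls_positive mu)
    (a : R -> X -> X -> R[i]) (m C c : R)
    (m_ge2 : 2 <= m) (C_gt0 : 0 < C) (c_gt0 : 0 < c)
    (a_meas : kernel_measurable a)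
    (a_bound : kernel_bound mu a m C c)
    (a_comm : operators_commute mu a)
    (w : X -> R) (w_A1 : is_A1 mu w)
    (f : X -> R[i]) (f_BMO : in_BMO mu a m w f) :
  exists c1 c2 : R, [/\ 0 < c1, 0 < c2 &
    forall (x : X) (r lam : R), 0 < r -> 0 < lam ->
      (wmeas mu w [set y | ball x r y /\
          (lam < cabs ((f y - opA mu a (r `^ m) f y) * ((w y)^-1)%:C))%R]
       <= if bmo_norm mu a m w f == 0 then 0
          else c1%:E * wmeas mu w (ball x r) *
               (expR (- (c2 * lam / fine (bmo_norm mu a m w f))))%:E)%E].
Proof.
have [K K1 mu_dbl] := mu_doubling.
have [Cw Cw1 w_avg] := A1_average mu_dbl mu_balls w_A1.
have [Kw Kw1 w_dbl] := wmeas_doubling K1 mu_dbl mu_balls w_A1.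
have w_pos := wmeas_balls_positive mu_dbl mu_balls w_A1.
have [fM noo] := f_BMO.
have osc_le := osc_le_bmo_norm w_A1 w_pos noo.
have n0 := bmo_norm_ge0 a m f w_A1.
have N0 : 0 <= fine (bmo_norm mu a m w f) by exact: fine_ge0.
have [Q Q0 comparison] := osc_comparison K1 mu_dbl mu_balls m_ge2 C_gt0 c_gt0
  a_meas a_bound a_comm w_A1 Cw1 Kw1 w_avg w_dbl fM N0 osc_le.
have mosc s : 0 < s -> measurable_fun setT (osc mu a m f s : borel X -> R).
  exact: (measurable_osc mu_dbl m a_meas fM).
have w0 := weight_ge0 w_A1; have mw := weight_measurable w_A1.
(* Where w vanishes, so does the inverse, and the left-hand condition fails. *)
have reduce x r lam : 0 < lam -> (wmeas mu w [set y | ball x r y /\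
      (lam < cabs ((f y - opA mu a (r `^ m) f y) * ((w y)^-1)%:C))%R] <=
    wmeas mu w [set y | ball x r y /\ exceedance w (osc mu a m f) r lam y])%E.
  move=> lam0; rewrite /wmeas integral_mkcond [leRHS]integral_mkcond.
  apply: ge0_le_integral_nonmeas => y; rewrite !patchE.
    by case: ifP => // _; rewrite lee_fin.
  case: ifP => [/set_mem[xy]|_]; last by case: ifP => // _; rewrite lee_fin.
  rewrite cabsM cabs_real ger0_norm ?invr_ge0// => ly.
  rewrite mem_set//; split => //; rewrite /exceedance.
  have [wy0|wy0] := eqVneq (w y) 0.
    by move: ly; rewrite wy0 invr0 mulr0 ltNge (ltW lam0).
  by rewrite -ltr_pdivlMr// lt_neqAle eq_sym wy0 w0.
pose kappa := good_level Kw * Kw + Q * (good_level Kw + 1).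
have L0 : 0 < good_level Kw by rewrite mulr_gt0// exprn_gt0// (lt_le_trans _ Kw1).
have kappa0 : 0 < kappa.
  by rewrite addr_gt0// mulr_gt0// ?addr_gt0// (lt_le_trans _ Kw1).
have ln20 : 0 < ln 2 :> R by rewrite ln_gt0// ltr1n.
exists 2, (ln 2 / kappa); split => //; first by rewrite divr_gt0.
move=> x r lam r0 lam0; apply: (le_trans (reduce x r lam lam0)).
have mE := measurable_exceedance w_A1 mosc x lam r0.
case: eqP => [norm0|/eqP norm_neq0].
  rewrite (_ : wmeas _ _ _ = 0%E)//; apply: wmeas_null => //.
  apply: (@null_of_le_wmeas R X mu (osc mu a m f r) (fun y => lam * w y)) => //.
  - exact: mosc.
  - by move=> y; exact: osc_ge0.
  - by apply: measurable_funM.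
  - by move=> y; rewrite mulr_ge0// ltW.
  - rewrite wmeasZ ?(ltW lam0)//; apply: lte_mul_pinfty; rewrite ?lee_fin ?(ltW lam0)//.
    apply: le_lt_trans (wmeas_ball_fin w_A1 x r).
    by apply: le_wmeas => // y [].
  - by move=> y [].
  - apply: (@le_trans _ _ 0%E); last by apply: wmeas_ge0 => y; rewrite mulr_ge0// ltW.
    apply: (@le_trans _ _ (wmeas mu (osc mu a m f r) (ball x r))).
      apply: le_wmeas => //; [exact: mosc|by move=> y; exact: osc_ge0|by move=> y []].
    by apply: (le_trans (osc_le x r r0)); rewrite norm0 mul0r.
set N := fine (bmo_norm mu a m w f) in N0 osc_le comparison *.
have Ngt0 : 0 < N.
  by rewrite fine_gt0// noo andbT lt0e norm_neq0 n0.
have large := osc_large_ball mu_dbl mu_balls a_meas w_A1 Kw1 w_dbl fM N0 osc_le.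
have kN0 : 0 < kappa * N by rewrite mulr_gt0.
pose n := Num.truncn (lam / (kappa * N)).
have lamn : good_step Kw N Q * n%:R <= lam.
  rewrite mulrC -ler_pdivlMr//; by rewrite truncn_le divr_ge0 ?(ltW lam0) ?(ltW kN0).
apply: (le_trans (exceedance_decay w_A1 Kw1 w_dbl w_pos Ngt0 Q0
  (fun s y => osc_ge0 mu a m f s y) mosc osc_le large comparison x r0 lamn)).
rewrite (wvolE w_A1) -!EFinM lee_fin.
rewrite [leRHS]mulrAC [leRHS]mulrC ler_wpM2l ?(wvol_ge0 w_A1)//.
have lt_n : lam / (kappa * N) < n.+1%:R by exact: truncnS_gt.
rewrite (_ : ln 2 / kappa * lam / N = ln 2 * (lam / (kappa * N))); last first.
  by field; rewrite !gt_eqF.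
(* The factor 2 = c1 makes up for replacing lam / (kappa N) by its integral part. *)
have -> : (2 ^+ n)^-1 = 2 * expR (- (ln 2 * n.+1%:R)) :> R.
  rewrite expRN (mulrC (ln 2)) expRM_natl lnK ?posrE// exprS.
  by rewrite invfM mulrA mulfV ?mul1r// pnatr_eq0.
by rewrite ler_pM2l// ler_expR lerN2 ler_pM2l// ltW.
Qed.
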